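(* Let $\gamma$ be the Lie 2-algebra of a strict Lie 2-group, $F:\mathcal X\to\mathcal Y$ an anafunctor between Lie groupoids, $\Phi\in\Omega^p(\mathcal Y,\gamma)$, and $\nu=(\nu_0,\nu_1)$ a $\Phi$-pullback on $F$. Then there exists a unique $\Psi\in\Omega^p(\mathcal X,\gamma)$ such that $$t_*(\nu_0)=\alpha_l^*\Psi^a-\alpha_r^*\Phi^a,\qquad \rho_l^*\nu_0=\mathrm{pr}_{\mathrm{Mor}(\mathcal X)}^*\Psi^b+\mathrm{pr}_F^*\nu_0,\qquad \nu_1=\alpha_l^*\Psi^c-\alpha_r^*\Phi^c,$$ where $\alpha_l,\alpha_r$ are the left and right anchors of $F$, and the second equation holds over $\mathrm{Mor}(\mathcal X)\,{}_s\!\times_{\alpha_l}F$ with $\rho_l$ the left $\mathcal X$-action on $F$.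
   Context: **Lie 2-algebra.** $\gamma=(\mathfrak h,\mathfrak g,t_*,\alpha_* )$: Lie algebras $\mathfrak g,\mathfrak h$, a Lie algebra homomorphism $t_*:\mathfrak h\to\mathfrak g$ and an action $\alpha_*$ of $\mathfrak g$ on $\mathfrak h$ by derivations with $\alpha_*(t_*(Y_1),Y_2)=[Y_1,Y_2]$, $t_*\alpha_*(X,Y)=[X,t_*(Y)]$. **Anafunctors.** In Lie groupoids $\chi\circ\rho$ is defined when $s(\chi)=t(\rho)$. An anafunctor $F:\mathcal X\to\mathcal Y$ is a manifold $F$ with a left $\mathcal X$-action with anchor $\alpha_l:F\to\mathrm{Obj}(\mathcal X)$ ($\chi\circ f$ defined for $s(\chi)=\alpha_l(f)$, $\alpha_l(\chi\circ f)=t(\chi)$) and a right $\mathcal Y$-action with anchor $\alpha_r:F\to\mathrm{Obj}(\mathcal Y)$ ($f\circ\eta$ defined for $\alpha_r(f)=t(\eta)$, $\alpha_r(f\circ\eta)=s(\eta)$), commuting and preserving each other's anchors, such that $\alpha_l$ is a surjective submersion and $(f,\eta)\mapsto(f,f\circ\eta)$ is a diffeomorphism $F\,{}_{\alpha_r}\!\times_t\mathrm{Mor}(\mathcal Y)\to F\times_{\mathrm{Obj}(\mathcal X)}F$. **Forms.** For a Lie groupoid $\mathcal P$ put $\Delta=t^*-s^*$ on forms on $\mathrm{Obj}(\mathcal P)$ and $\Delta=\mathrm{pr}_1^*-c^*+\mathrm{pr}_2^*$ on forms on $\mathrm{Mor}(\mathcal P)$ ($c$ is composition of composable pairs). $\Psi\in\Omega^p(\mathcal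 P,\gamma)$ is a triple $\Psi^a\in\Omega^p(\mathrm{Obj}(\mathcal P),\mathfrak g)$, $\Psi^b\in\Omega^p(\mathrm{Mor}(\mathcal P),\mathfrak h)$, $\Psi^c\in\Omega^{p+1}(\mathrm{Obj}(\mathcal P),\mathfrak h)$ with $\Delta\Psi^a=t_*(\Psi^b)$, $\Delta\Psi^b=0$. **$\Phi$-pullback.** For $\Phi\in\Omega^p(\mathcal Y,\gamma)$, a $\Phi$-pullback on $F$ is a pair $\nu=(\nu_0,\nu_1)$, $\nu_0\in\Omega^p(F,\mathfrak h)$, $\nu_1\in\Omega^{p+1}(F,\mathfrak h)$, with $\rho_r^*\nu_0=\mathrm{pr}_F^*\nu_0+\mathrm{pr}_{\mathrm{Mor}(\mathcal Y)}^*\Phi^b$ and $\rho_r^*\nu_1=\mathrm{pr}_F^*\nu_1+\mathrm{pr}_{\mathrm{Mor}(\mathcal Y)}^*\Delta\Phi^c$ over $F\,{}_{\alpha_r}\!\times_t\mathrm{Mor}(\mathcal Y)$, where $\rho_r$ is the right $\mathcal Y$-action. *)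

(* Defs.v *)
(* MathComp-Analysis: manifolds are modelled on 'rV[R]_n for R : realType. *)
From HB Require Import structures.
From mathcomp Require Import all_boot all_order all_algebra.
From mathcomp Require Import boolp classical_sets functions cardinality reals.
From mathcomp Require Import topology normedtype derive.

Set Implicit Arguments.
Unset Strict Implicit.
Unset Printing Implicit Defensive.

Import Order.TTheory GRing.Theory Num.Theory.
Import numFieldNormedType.Exports.

Local Open Scope classical_set_scope.
Local Open Scope ring_scope.

(* C^k on an open set U; values of f outside U are irrelevant. *)
Fixpoint Ck_on (R : realType) (n : nat) (W : normedModType R) (k : nat)
    (U : set 'rV[R]_n) (f : 'rV[R]_n -> W) : Prop :=
  match k with
  | 0 => forall x, U x -> {for x, continuous f}
  | k'.+1 => (forall x, U x -> differentiable f x) /\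
             (forall v : 'rV[R]_n, Ck_on k' U (fun x => 'd f x v))
  end.

Definition smooth_on (R : realType) (n : nat) (W : normedModType R)
    (U : set 'rV[R]_n) (f : 'rV[R]_n -> W) : Prop :=
  forall k : nat, Ck_on k U f.

Record chart (R : realType) (T : topologicalType) (n : nat) := Chart {
  cdom : set T;
  ccod : set 'rV[R]_n;
  cfun : T -> 'rV[R]_n;
  cinv : 'rV[R]_n -> T;
  cdom_open : open cdom;
  ccod_open : open ccod;
  cfunS : forall x, cdom x -> ccod (cfun x);
  cinvS : forall y, ccod y -> cdom (cinv y);
  cfunK : forall x, cdom x -> cinv (cfun x) = x;
  cinvK : forall y, ccod y -> cfun (cinv y) = y;
  cfun_continuous : forall x, cdom x -> {for x, continuous cfun};
  cinv_continuous : forall y, ccod y -> {for y, continuous cinv}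
}.

(* The atlas is [{chart_at x | x}]: it comes with a preferred chart around each
   point.  Any atlas restricts to an equivalent one of this form; the choice
   only serves to identify the tangent space at x with 'rV_n (see [mdiff]). *)
Record manifold (R : realType) := Manifold {
  msort :> topologicalType;
  mdim : nat;
  chart_at : msort -> chart R msort mdim;
  mhausdorff : hausdorff_space msort;
  msecond_countable : @second_countable msort;
  chart_at_dom : forall x, cdom (chart_at x) x;
  chart_at_compat : forall x y : msort,
    smooth_on (ccod (chart_at x) `&` cinv (chart_at x) @^-1` cdom (chart_at y))
              (cfun (chart_at y) \o cinv (chart_at x))
}.

Definition smooth (R : realType) (M N : manifold R) (f : M -> N) : Prop :=
  continuous f /\
  forall (x : M) (y : N),
    smooth_on
      (ccod (chart_at x) `&` (f \o cinv (chart_at x)) @^-1` cdom (chart_at y))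
      (cfun (chart_at y) \o f \o cinv (chart_at x)).

(* The differential T_x M -> T_(f x) N, tangent spaces being identified with row
   vectors through the preferred charts at x and at f x. *)
Definition mdiff (R : realType) (M N : manifold R) (f : M -> N) (x : M)
    (v : 'rV[R]_(mdim M)) : 'rV[R]_(mdim N) :=
  'd (cfun (chart_at (f x)) \o f \o cinv (chart_at x))
     (cfun (chart_at x) x) v.

Definition surjective_submersion (R : realType) (M N : manifold R)
    (f : M -> N) : Prop :=
  [/\ smooth f,
      forall y, exists x, f x = y &
      forall (x : M) (w : 'rV[R]_(mdim N)),
        exists v : 'rV[R]_(mdim M), mdiff f x v = w].

Definition diffeomorphism (R : realType) (M N : manifold R) (f : M -> N) :=
  smooth f /\
  exists g : N -> M, [/\ smooth g, cancel f g & cancel g f].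

(* The set {(x, y) | f x = g y} with the manifold structure for which a map
   into it is smooth iff its components are; by the Yoneda lemma this
   determines the structure up to unique diffeomorphism, and for f or g a
   submersion it is the usual submanifold of M x N.  The codomain B is a bare
   type, so that B := unit gives the product manifold. *)
Record fibre_product (R : realType) (M N : manifold R) (B : Type)
    (f : M -> B) (g : N -> B) := FibreProduct {
  fp :> manifold R;
  fp1 : fp -> M;
  fp2 : fp -> N;
  fpair : forall x y, f x = g y -> fp;
  fp1_smooth : smooth fp1;
  fp2_smooth : smooth fp2;
  fp_comm : forall z, f (fp1 z) = g (fp2 z);
  fpair1 : forall x y (e : f x = g y), fp1 (fpair e) = x;
  fpair2 : forall x y (e : f x = g y), fp2 (fpair e) = y;
  fp_inj : forall z z', fp1 z = fp1 z' -> fp2 z = fp2 z' -> z = z';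
  fp_smooth : forall (T : manifold R) (u : T -> fp),
    smooth (fp1 \o u) -> smooth (fp2 \o u) -> smooth u
}.
Arguments fp1 {R M N B f g} P _ : rename.
Arguments fp2 {R M N B f g} P _ : rename.
Arguments fpair {R M N B f g} P {x y} _ : rename.

Notation product_manifold M N :=
  (fibre_product (fun _ : msort M => tt) (fun _ : msort N => tt)).

Section Forms.
Variables (R : realType).

Definition pre_form (p : nat) (M : manifold R) (V : Type) :=
  forall x : M, ('I_p -> 'rV[R]_(mdim M)) -> V.

(* The last clause is the smoothness of the local representative of w on
   each chart, evaluated on constant vector fields; [v2r] is a linear
   isomorphism from V to a space of row vectors. *)
Definition is_form (p : nat) (M : manifold R) (V : vectType R)
    (w : pre_form p M V) : Prop :=
  [/\ forall x v i a (u u' : 'rV[R]_(mdim M)),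
        w x [eta v with i |-> a *: u + u'] =
        a *: w x [eta v with i |-> u] + w x [eta v with i |-> u'],
      forall x v i j, i != j -> v i = v j -> w x v = 0 &
      forall (z : M) (v : 'I_p -> 'rV[R]_(mdim M)),
        smooth_on (ccod (chart_at z)) (fun y =>
          let x := cinv (chart_at z) y in
          VectorInternalTheory.v2r (w x (fun i =>
            'd (cfun (chart_at x) \o cinv (chart_at z)) y (v i))))].

Record form (p : nat) (M : manifold R) (V : vectType R) := Form {
  form_val :> pre_form p M V;
  formP : is_form form_val
}.

Definition pullback (p : nat) (M N : manifold R) (V : Type) (f : M -> N)
    (w : pre_form p N V) : pre_form p M V :=
  fun x v => w (f x) (fun i => mdiff f x (v i)).

Definition form_add (p : nat) (M : manifold R) (V : vectType R)
    (w w' : pre_form p M V) : pre_form p M V := fun x v => w x v + w' x v.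

Definition form_sub (p : nat) (M : manifold R) (V : vectType R)
    (w w' : pre_form p M V) : pre_form p M V := fun x v => w x v - w' x v.

Definition form_map (p : nat) (M : manifold R) (V V' : Type) (f : V -> V')
    (w : pre_form p M V) : pre_form p M V' := fun x v => f (w x v).

End Forms.

Declare Scope form_scope.
Delimit Scope form_scope with form.
Bind Scope form_scope with pre_form.
Notation "w + w'" := (form_add w w') : form_scope.
Notation "w - w'" := (form_sub w w') : form_scope.

Record lie_algebra (R : realType) := LieAlgebra {
  la_sort :> vectType R;
  bracket : la_sort -> la_sort -> la_sort;
  bracket_linearl : forall z, linear (bracket^~ z);
  bracket_linearr : forall z, linear (bracket z);
  bracket_alt : forall x, bracket x x = 0;
  bracket_jacobi : forall x y z,
    bracket x (bracket y z) + bracket y (bracket z x) +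
    bracket z (bracket x y) = 0
}.

Record lie2_algebra (R : realType) := Lie2Algebra {
  l2h : lie_algebra R;
  l2g : lie_algebra R;
  l2t : {linear l2h -> l2g};
  l2a : l2g -> l2h -> l2h;
  l2t_bracket : forall y y', l2t (bracket y y') = bracket (l2t y) (l2t y');
  l2a_linearl : forall y, linear (l2a^~ y);
  l2a_linearr : forall x, linear (l2a x);
  l2a_bracket : forall x x' y,
    l2a (bracket x x') y = l2a x (l2a x' y) - l2a x' (l2a x y);
  l2a_derivation : forall x y y',
    l2a x (bracket y y') = bracket (l2a x y) y' + bracket y (l2a x y');
  l2a_peiffer : forall y y', l2a (l2t y) y' = bracket y y';
  l2t_equivariant : forall x y, l2t (l2a x y) = bracket x (l2t y)
}.

Record lie_group (R : realType) := LieGroup {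
  lg_mfd :> manifold R;
  lg_prod : product_manifold lg_mfd lg_mfd;
  lg_mul : lg_mfd -> lg_mfd -> lg_mfd;
  lg_one : lg_mfd;
  lg_inv : lg_mfd -> lg_mfd;
  lg_mulA : associative lg_mul;
  lg_mul1 : left_id lg_one lg_mul;
  lg_mulV : left_inverse lg_one lg_inv lg_mul;
  lg_mul_smooth : smooth (fun z : lg_prod => lg_mul (fp1 _ z) (fp2 _ z));
  lg_inv_smooth : smooth lg_inv
}.
Arguments lg_one {R} l.

Definition lg_conj (R : realType) (G : lie_group R) (g x : G) : G :=
  lg_mul (lg_mul g x) (lg_inv g).

(* A strict Lie 2-group, presented as a crossed module of Lie groups: the
   morphisms of the 2-group with source 1 form H, and t is the target map. *)
Record lie_2group (R : realType) := Lie2Group {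
  L2H : lie_group R;
  L2G : lie_group R;
  L2t : L2H -> L2G;
  L2prod : product_manifold L2G L2H;
  L2a : L2G -> L2H -> L2H;
  L2t_smooth : smooth L2t;
  L2t_mul : forall h h', L2t (lg_mul h h') = lg_mul (L2t h) (L2t h');
  L2a_smooth : smooth (fun z : L2prod => L2a (fp1 _ z) (fp2 _ z));
  L2a_one : forall h, L2a (lg_one L2G) h = h;
  L2a_act : forall g g' h, L2a (lg_mul g g') h = L2a g (L2a g' h);
  L2a_mul : forall g h h', L2a g (lg_mul h h') = lg_mul (L2a g h) (L2a g h');
  L2t_equiv : forall g h, L2t (L2a g h) = lg_conj g (L2t h);
  L2_peiffer : forall h h', L2a (L2t h) h' = lg_conj h h'
}.

(* For an action a of G on H by automorphisms, the derivative at g = 1 in the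
   direction X of the map g |-> (d_1 (a g)) Y from G to T_1 H. *)
Definition derived_action (R : realType) (G H : lie_group R)
    (a : G -> H -> H) (X : 'rV[R]_(mdim G)) (Y : 'rV[R]_(mdim H))
    : 'rV[R]_(mdim H) :=
  let c := chart_at (lg_one G) in
  'd ((fun g => mdiff (a g) (lg_one H) Y) \o cinv c) (cfun c (lg_one G)) X.

(* The bracket of T_1 G is the derivative of the adjoint action Ad. *)
Definition lg_bracket (R : realType) (G : lie_group R)
    (X Y : 'rV[R]_(mdim G)) : 'rV[R]_(mdim G) :=
  derived_action (@lg_conj R G) X Y.

Definition is_lie2_algebra_of (R : realType) (Gamma : lie_2group R)
    (gamma : lie2_algebra R) : Prop :=
  exists (ig : {linear l2g gamma -> 'rV[R]_(mdim (L2G Gamma))})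
         (ih : {linear l2h gamma -> 'rV[R]_(mdim (L2H Gamma))}),
    [/\ bijective ig /\ bijective ih,
        forall X X', ig (bracket X X') = lg_bracket (ig X) (ig X'),
        forall Y Y', ih (bracket Y Y') = lg_bracket (ih Y) (ih Y'),
        forall Y, ig (l2t gamma Y) =
          mdiff (@L2t R Gamma) (lg_one (L2H Gamma)) (ih Y) &
        forall X Y, ih (l2a X Y) = derived_action (@L2a R Gamma) (ig X) (ih Y)].

(* [mcomp x y] (first y, then x) lives on pairs with [src x = tgt y]; [comp2] is
   the manifold of composable pairs. *)
Record lie_groupoid (R : realType) := LieGroupoid {
  Obj : manifold R;
  Mor : manifold R;
  src : Mor -> Obj;
  tgt : Mor -> Obj;
  src_submersion : surjective_submersion src;
  tgt_submersion : surjective_submersion tgt;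
  comp2 : fibre_product src tgt;
  mcomp : comp2 -> Mor;
  idm : Obj -> Mor;
  invm : Mor -> Mor;
  comp_smooth : smooth mcomp;
  idm_smooth : smooth idm;
  invm_smooth : smooth invm;
  src_comp : forall z, src (mcomp z) = src (fp2 _ z);
  tgt_comp : forall z, tgt (mcomp z) = tgt (fp1 _ z);
  src_idm : forall x, src (idm x) = x;
  tgt_idm : forall x, tgt (idm x) = x;
  src_invm : forall f, src (invm f) = tgt f;
  tgt_invm : forall f, tgt (invm f) = src f;
  compA : forall f g h (e1 : src f = tgt g) (e2 : src g = tgt h)
      (e3 : src f = tgt (mcomp (fpair comp2 e2)))
      (e4 : src (mcomp (fpair comp2 e1)) = tgt h),
    mcomp (fpair comp2 e3) = mcomp (fpair comp2 e4);
  comp_id_l : forall x f (e : src (idm x) = tgt f), mcomp (fpair comp2 e) = f;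
  comp_id_r : forall x f (e : src f = tgt (idm x)), mcomp (fpair comp2 e) = f;
  comp_invm_l : forall f (e : src (invm f) = tgt f),
    mcomp (fpair comp2 e) = idm (src f);
  comp_invm_r : forall f (e : src f = tgt (invm f)),
    mcomp (fpair comp2 e) = idm (tgt f)
}.
Arguments src {R l}.
Arguments tgt {R l}.
Arguments mcomp {R} l.

Record anafunctor (R : realType) (X Y : lie_groupoid R) := Anafunctor {
  anaF :> manifold R;
  anal : anaF -> Obj X;
  anar : anaF -> Obj Y;
  anal_submersion : surjective_submersion anal;
  anar_smooth : smooth anar;
  ana_lprod : fibre_product (@src R X) anal;
  ana_rprod : fibre_product anar (@tgt R Y);
  lact : ana_lprod -> anaF;
  ract : ana_rprod -> anaF;
  lact_smooth : smooth lact;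
  ract_smooth : smooth ract;
  anal_lact : forall z, anal (lact z) = tgt (fp1 _ z);
  anar_lact : forall z, anar (lact z) = anar (fp2 _ z);
  anar_ract : forall z, anar (ract z) = src (fp2 _ z);
  anal_ract : forall z, anal (ract z) = anal (fp1 _ z);
  lact_id : forall x f (e : src (idm x) = anal f),
    lact (fpair ana_lprod e) = f;
  ract_id : forall y f (e : anar f = tgt (idm y)),
    ract (fpair ana_rprod e) = f;
  lact_comp : forall g h f (e1 : src g = tgt h) (e2 : src h = anal f)
      (e3 : src (mcomp X (fpair (comp2 X) e1)) = anal f)
      (e4 : src g = anal (lact (fpair ana_lprod e2))),
    lact (fpair ana_lprod e3) = lact (fpair ana_lprod e4);
  ract_comp : forall f g h (e1 : src g = tgt h) (e2 : anar f = tgt g)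
      (e3 : anar f = tgt (mcomp Y (fpair (comp2 Y) e1)))
      (e4 : anar (ract (fpair ana_rprod e2)) = tgt h),
    ract (fpair ana_rprod e3) = ract (fpair ana_rprod e4);
  act_commute : forall g f h (e1 : src g = anal f) (e2 : anar f = tgt h)
      (e3 : src g = anal (ract (fpair ana_rprod e2)))
      (e4 : anar (lact (fpair ana_lprod e1)) = tgt h),
    lact (fpair ana_lprod e3) = ract (fpair ana_rprod e4);
  ana_sq : fibre_product anal anal;
  ana_principal : diffeomorphism (fun z : ana_rprod =>
    fpair ana_sq (esym (anal_ract z)))
}.

Arguments anal {R X Y} a.
Arguments anar {R X Y} a.
Arguments lact {R X Y} a.
Arguments ract {R X Y} a.

Definition DeltaObj (R : realType) (P : lie_groupoid R) (p : nat)
    (V : vectType R) (w : pre_form p (Obj P) V) : pre_form p (Mor P) V :=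
  (pullback tgt w - pullback src w)%form.

Definition DeltaMor (R : realType) (P : lie_groupoid R) (p : nat)
    (V : vectType R) (w : pre_form p (Mor P) V) : pre_form p (comp2 P) V :=
  (pullback (fp1 (comp2 P)) w - pullback (mcomp P) w
    + pullback (fp2 (comp2 P)) w)%form.

Record gform (R : realType) (p : nat) (P : lie_groupoid R)
    (gamma : lie2_algebra R) := GForm {
  gfa : form p (Obj P) (l2g gamma);
  gfb : form p (Mor P) (l2h gamma);
  gfc : form p.+1 (Obj P) (l2h gamma);
  gfa_Delta : DeltaObj gfa = form_map (l2t gamma) gfb;
  gfb_Delta : DeltaMor gfb = fun _ _ => 0
}.

Record Phi_pullback (R : realType) (p : nat) (X Y : lie_groupoid R)
    (gamma : lie2_algebra R) (F : anafunctor X Y) (Phi : gform p Y gamma) :=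
  PhiPullback {
  nu0 : form p F (l2h gamma);
  nu1 : form p.+1 F (l2h gamma);
  nu0P : pullback (ract F) nu0 =
    (pullback (fp1 (ana_rprod F)) nu0
     + pullback (fp2 (ana_rprod F)) (gfb Phi))%form;
  nu1P : pullback (ract F) nu1 =
    (pullback (fp1 (ana_rprod F)) nu1
     + pullback (fp2 (ana_rprod F)) (DeltaObj (gfc Phi)))%form
}.

(* Main.v *)
From Pilot Require Import Defs.
From HB Require Import structures.
From mathcomp Require Import all_boot all_order all_algebra.
From mathcomp Require Import boolp classical_sets functions cardinality reals.
From mathcomp Require Import interval_inference.
From mathcomp Require Import topology normedtype sequences derive landau.
From mathcomp Require Import ring lra.

(* A form on F descends along the surjective submersion al : F -> Obj X as soon
   as its values at tangent vectors with the same image under d(al) agree.  Two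
   points of F over the same object are f and f.eta, and F x_{Obj X} F is
   diffeomorphic to F x_{Obj Y} Mor Y by principality, so for
   t_*(nu0) + ar^* Phi^a and nu1 + ar^* Phi^c this is the defining property of
   a Phi-pullback.  Likewise rho_l^* nu0 - pr_F^* nu0 descends along the
   surjective submersion pr : Mor X x F -> Mor X, because
   rho_l(chi, f.eta) = rho_l(chi, f).eta.  The identities for Psi hold after
   pulling back along these submersions, which is injective on forms.
   Tangent vectors of fibre products are handled by lifting curves through a
   submersion; this and the smoothness of the descended forms rest on the
   inverse function theorem. *)

Set Implicit Arguments.
Unset Strict Implicit.
Unset Printing Implicit Defensive.

Import Order.TTheory GRing.Theory Num.Theory.
Import numFieldNormedType.Exports.
Import VectorInternalTheory.

Local Open Scope classical_set_scope.
Local Open Scope ring_scope.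

(** * Differential calculus on R^n *)

Section differential.
Variable R : realType.

(** The obstacle is that a [fibre_product] is known only through smooth maps into it from manifolds:
    nothing says a priori that its tangent spaces are fibre products of tangent spaces. A tangent
    vector with given components is produced as the velocity of a curve; that its components
    determine it requires a local left inverse of [(fp1, fp2)], hence a smooth map from a whole
    Euclidean space into the fibre product. Identities such as the commutation of the two actions
    live on triple fibre products, for which no manifold is given. They are differentiated along
    curves instead: each factor is a curve in one of the given manifolds, the identity holds at
    every time, and velocities at the origin are compared. Since the universal property concerns
    globally defined maps, a curve found only near the origin is reparametrised so as to be defined
    on the whole line. *)

Lemma rV_linear_sum n (W : lmodType R) (f : {linear 'rV[R]_n -> W}) v :
  f v = \sum_j v 0 j *: f (delta_mx 0 j).
Proof.
by rewrite {1}(row_sum_delta v) linear_sum; apply: eq_bigr => j _; rewrite linearZ.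
Qed.

Lemma rV_linear_continuous n (W : normedModType R) (f : {linear 'rV[R]_n -> W}) :
  continuous f.
Proof.
have -> : (f : _ -> _) = \sum_j (fun v : 'rV[R]_n => v 0 j *: f (delta_mx 0 j)).
  by apply/funext => v; rewrite fct_sumE; exact: rV_linear_sum.
apply: (big_ind (fun g : 'rV[R]_n -> W => continuous g)).
- exact: cst_continuous.
- move=> g h gc hc x; apply: (@continuousD _ _ _ g h); [exact: gc|exact: hc].
- move=> j _ x; apply: (@cvgZr_tmp _ _ _ (nbhs x) _ (fun v : 'rV[R]_n => v 0 j)).
  exact: coord_continuous.
Qed.

(** Spells out the little-o remainder as an epsilon estimate, the shape in which the remainder of a
    local inverse is bounded later. *)
Lemma is_diffP (V W : normedModType R) (f : V -> W) (L : {linear V -> W}) x :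
  is_diff x f L <-> continuous L /\ forall e, 0 < e ->
    \forall y \near x, `|f y - f x - L (y - x)| <= e * `|y - x|.
Proof.
split=> [[df dfE]|[Lc HL]].
  split; first by rewrite -dfE; exact: diff_continuous.
  move=> e e0; have /diff_locally/eqaddoP/(_ _ e0) := df.
  move=> H; apply/nbhs0P; apply: filterS H => y /=.
  by rewrite !fctE /= dfE opprD addrA (addrC x) addrK.
have H : f \o shift x = cst (f x) + L +o_ 0 id.
  apply/eqaddoP => e /HL/nbhs0P; apply: filterS => y /=.
  by rewrite !fctE /= opprD addrA (addrC x) addrK.
have E := diff_unique Lc H.
by split => //; apply/diff_locallyP; rewrite E.
Qed.

Lemma near_eq_is_diff (V W : normedModType R) (f g : V -> W)  x df :
  (\forall y \near x, f y = g y) -> is_diff x f df -> is_diff x g df.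
Proof.
move=> fg dfx; have [dif E] := dfx; move: dfx.
rewrite -E => /is_diffP[Lc H]; apply/is_diffP; split=> // e /H.
have fgx : f x = g x by exact: nbhs_singleton fg.
by apply: filterS2 fg => y -> ; rewrite fgx.
Qed.

(** Scaling is packed as a bilinear map, so that the Leibniz rule is the chain rule for
    [y |-> (f y, g y)] followed by a continuous bilinear map. *)
Lemma is_diff_scale (V W : normedModType R) (f : V -> R) (g : V -> W) df dg x :
  is_diff x f df -> is_diff x g dg ->
  is_diff x (fun y => f y *: g y) (fun v => df v *: g x + f x *: dg v).
Proof.
move=> dfx dgx.
have sb : bilinear_for (GRing.Scale.Law.clone _ _ *:%R _)
   (GRing.Scale.Law.clone _ _ *:%R _) (fun (a : R) (w : W) => a *: w).
  split=> [u'|u] a y z /=; first by rewrite scalerDl scalerA.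
  by rewrite scalerDr !scalerA mulrC.
pose bM := bilinear_isBilinear.Build R R W W _ _ _ sb.
pose b : {bilinear R -> W -> W} := HB.pack (fun (a : R) (w : W) => a *: w) bM.
have bc : continuous (fun p : R * W => b p.1 p.2).
  by move=> p; exact: scale_continuous.
have db p : is_diff p (fun q : R * W => b q.1 q.2) (fun q => b p.1 q.2 + b q.1 p.2).
  by split; [exact: differentiable_bilin|exact: diff_bilin].
have dp := @is_diff_pair _ _ _ _ _ _ _ _ _ dfx dgx.
have := @is_diff_comp _ _ _ _ _ _ _ _ _ dp (db _).
case=> H1 H2.
have E : (fun y => f y *: g y) = (fun q : R * W => b q.1 q.2) \o (fun y => (f y, g y)) by [].
rewrite E; split; [exact: H1|rewrite H2]; apply/funext => v /=.
exact: addrC.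
Qed.

End differential.

Lemma near_eq_continuous (T S : topologicalType) (f g : T -> S) x :
  (\forall y \near x, f y = g y) ->
  {for x, continuous f} -> {for x, continuous g}.
Proof.
move=> fg; rewrite /prop_for /continuous_at (nbhs_singleton fg) => fx.
by apply: cvg_trans fx; exact: near_eq_cvg.
Qed.

(** * Closure properties of C^k maps on open sets *)

Section Ck.
Variables (R : realType) (n : nat).
Implicit Types (U V : set 'rV[R]_n) (W : normedModType R).

Lemma Ck_on_sub W k U V (f : 'rV[R]_n -> W) :
  U `<=` V -> Ck_on k V f -> Ck_on k U f.
Proof.
elim: k f => [|k IH] f UV /= => [H x /UV|[d H]]; first exact: H.
by split=> [x /UV|v]; [exact: d|exact: IH].
Qed.

(** [Ck_on] is a family of conditions at single points, with differentials taken in the whole space,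
    so a different set [V] may serve around each point. *)
Lemma Ck_on_local W k U (f : 'rV[R]_n -> W) :
  (forall x, U x -> exists2 V, V x & Ck_on k V f) -> Ck_on k U f.
Proof.
elim: k f => [|k IH] f H /=; first by move=> x /H[V Vx]; exact.
split=> [x /H[V Vx [d _]]|v]; first exact: d.
by apply: IH => x /H[V Vx [_ d]]; exists V => //; exact: d.
Qed.

(** Functions that agree on an open set have the same germs at its points, hence the same
    differentials there, and the induction passes to the derivatives. *)
Lemma Ck_on_ext W k U (f g : 'rV[R]_n -> W) : open U ->
  (forall x, U x -> f x = g x) -> Ck_on k U f -> Ck_on k U g.
Proof.
move=> Uo; have nearU x : U x -> \forall y \near x, U y.
  by move=> Ux; exact: open_nbhs_nbhs (conj Uo Ux).
elim: k f g => [|k IH] f g fg /=.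
  move=> fc x Ux; apply: near_eq_continuous (fc x Ux).
  by apply: filterS (nearU x Ux).
move=> [df Df].
have dg x : U x -> is_diff x g ('d f x).
  move=> Ux; apply: (@near_eq_is_diff _ _ _ f).
    by apply: filterS (nearU x Ux).
  by split => //; exact: df.
by split=> [x /dg[]//|v]; apply: IH (Df v) => x /dg[_ ->].
Qed.

(** Lets an explicit formula for the derivative on [U] stand in for ['d f]; most closure properties
    below are inductions through it. *)
Lemma Ck_onS W k U (f : 'rV[R]_n -> W) (df : 'rV[R]_n -> 'rV[R]_n -> W) :
  open U -> (forall x, U x -> is_diff x f (df x)) ->
  (forall v, Ck_on k U (df^~ v)) -> Ck_on k.+1 U f.
Proof.
move=> Uo fd Hk; split=> [x /fd[]//|v].
by apply: Ck_on_ext (Hk v) => // x /fd[_ ->].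
Qed.

Lemma Ck_on_is_diff W k U (f : 'rV[R]_n -> W) x :
  Ck_on k.+1 U f -> U x -> is_diff x f ('d f x).
Proof. by case=> + _ Ux => /(_ _ Ux). Qed.

Lemma Ck_onW W k U (f : 'rV[R]_n -> W) : Ck_on k.+1 U f -> Ck_on k U f.
Proof.
elim: k f => [|k IH] f /=.
  by case=> d _ x /d; exact: differentiable_continuous.
by case=> d H; split=> // v; exact: IH.
Qed.

Lemma Ck_on_cst W k U (a : W) : Ck_on k U (fun=> a).
Proof.
elim: k a => [|k IH] a; first by move=> x _; exact: cst_continuous.
split=> [x _|v]; first exact: differentiable_cst.
rewrite (_ : (fun x => _) = fun=> 0) //.
by apply/funext => x; rewrite diff_cst.
Qed.

Lemma Ck_on_linear W k U (f : {linear 'rV[R]_n -> W}) : Ck_on k U f.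
Proof.
case: k => [|k]; first by move=> x _; exact: rV_linear_continuous.
split=> [x _|v].
  by apply: linear_differentiable; exact: rV_linear_continuous.
rewrite (_ : (fun x => _) = fun=> f v); first exact: Ck_on_cst.
by apply/funext => x; rewrite diff_lin//; exact: rV_linear_continuous.
Qed.

Lemma Ck_onD W k U (f g : 'rV[R]_n -> W) : open U ->
  Ck_on k U f -> Ck_on k U g -> Ck_on k U (fun x => f x + g x).
Proof.
move=> Uo; elim: k f g => [|k IH] f g fk gk.
  by move=> x Ux; apply: (@continuousD _ _ _ f g); [exact: fk|exact: gk].
apply: (@Ck_onS _ _ _ _ (fun x v => 'd f x v + 'd g x v)) => //.
  move=> x Ux; have := Ck_on_is_diff fk Ux; have := Ck_on_is_diff gk Ux.
  by move=> dg df; exact: is_diffD.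
by move=> v; apply: IH; [apply fk|apply gk].
Qed.

Lemma Ck_on_sum W k U I (r : seq I) (f : I -> 'rV[R]_n -> W) : open U ->
  (forall i, Ck_on k U (f i)) -> Ck_on k U (fun x => \sum_(i <- r) f i x).
Proof.
move=> Uo fk; elim: r => [|i r IH].
  rewrite (_ : (fun=> _) = fun=> 0); first exact: Ck_on_cst.
  by apply/funext => x; rewrite big_nil.
rewrite (_ : (fun=> _) = fun x => f i x + \sum_(j <- r) f j x).
  exact: Ck_onD.
by apply/funext => x; rewrite big_cons.
Qed.

Lemma Ck_onZ W k U (f : 'rV[R]_n -> R) (g : 'rV[R]_n -> W) : open U ->
  Ck_on k U f -> Ck_on k U g -> Ck_on k U (fun x => f x *: g x).
Proof.
move=> Uo; elim: k f W g => [|k IH] f W g fk gk.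
  by move=> x Ux; apply: (@continuousZ _ _ _ f g); [exact: fk|exact: gk].
apply: (@Ck_onS _ _ _ _ (fun x v => 'd f x v *: g x + f x *: 'd g x v)) => //.
  move=> x Ux; have := Ck_on_is_diff fk Ux; have := Ck_on_is_diff gk Ux.
  by move=> dg df; exact: is_diff_scale.
move=> v; apply: Ck_onD => //; apply: IH.
- by apply fk.
- exact: Ck_onW.
- exact: Ck_onW.
- by apply gk.
Qed.

Lemma Ck_onM k U (f g : 'rV[R]_n -> R) : open U ->
  Ck_on k U f -> Ck_on k U g -> Ck_on k U (fun x => f x * g x).
Proof. by move=> Uo fk gk; exact: Ck_onZ. Qed.

Lemma Ck_on_prod k U I (r : seq I) (f : I -> 'rV[R]_n -> R) : open U ->
  (forall i, Ck_on k U (f i)) -> Ck_on k U (fun x => \prod_(i <- r) f i x).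
Proof.
move=> Uo fk; elim: r => [|i r IH].
  rewrite (_ : (fun=> _) = fun=> 1); first exact: Ck_on_cst.
  by apply/funext => x; rewrite big_nil.
rewrite (_ : (fun=> _) = fun x => f i x * \prod_(j <- r) f j x).
  exact: Ck_onM.
by apply/funext => x; rewrite big_cons.
Qed.

(** The derivative of [1/f] is a polynomial in [1/f] and the derivative of [f], so the induction
    closes on [1/f] itself. *)
Lemma Ck_onV k U (f : 'rV[R]_n -> R) : open U -> (forall x, U x -> f x != 0) ->
  Ck_on k U f -> Ck_on k U (fun x => (f x)^-1).
Proof.
move=> Uo f0; elim: k => [|k IH] fk.
  by move=> x Ux; apply: (@continuousV _ _ f); [exact: f0|exact: fk].
apply: (@Ck_onS _ _ _ _ (fun x v => (- ((f x)^-1 * (f x)^-1)) * 'd f x v)) => //.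
  move=> x Ux; have df := Ck_on_is_diff fk Ux.
  split; first by apply: differentiableV; [exact: ex_diff|exact: f0].
  rewrite diffV//; last exact: f0.
  apply/funext => v; rewrite /= -exprVn expr2.
  by [].
move=> v; apply: Ck_onM => //; last by apply fk.
have V := IH (Ck_onW fk).
rewrite (_ : (fun=> _) = fun x => -1 * ((f x)^-1 * (f x)^-1)).
  by apply: Ck_onM => //; [exact: Ck_on_cst|exact: Ck_onM].
by apply/funext => x; rewrite mulN1r.
Qed.

Lemma Ck_on_linear_comp W W' k U (L : {linear W -> W'}) (f : 'rV[R]_n -> W) :
  open U -> continuous L -> Ck_on k U f -> Ck_on k U (L \o f).
Proof.
move=> Uo Lc; elim: k f => [|k IH] f fk.
  by move=> x Ux; apply: continuous_comp; [exact: fk|exact: Lc].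
apply: (@Ck_onS _ _ _ _ (fun x => L \o 'd f x)) => //.
  move=> x Ux; apply: is_diff_comp; first exact: Ck_on_is_diff fk Ux.
  by split; [exact: linear_differentiable|exact: diff_lin].
by move=> v; apply: IH; apply fk.
Qed.

Definition mx_coord m p (i : 'I_m) (j : 'I_p) (A : 'M[R]_(m, p)) : R := A i j.

Fact mx_coord_linear m p (i : 'I_m) (j : 'I_p) : linear (mx_coord i j).
Proof. by move=> a u v; rewrite /mx_coord !mxE. Qed.

HB.instance Definition _ m p (i : 'I_m) (j : 'I_p) :=
  GRing.isLinear.Build _ _ _ _ _ (mx_coord_linear i j).

Lemma Ck_on_coord m k U (f : 'rV[R]_n -> 'rV[R]_m) j : open U ->
  Ck_on k U f -> Ck_on k U (fun x => f x 0 j).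
Proof.
move=> Uo fk; apply: (@Ck_on_linear_comp _ _ _ _ (mx_coord 0 j)) => //.
exact: coord_continuous.
Qed.

Lemma Ck_on_row m k U (f : 'rV[R]_n -> 'rV[R]_m) : open U ->
  (forall j, Ck_on k U (fun x => f x 0 j)) -> Ck_on k U f.
Proof.
move=> Uo fk.
rewrite (_ : f = fun x => \sum_j f x 0 j *: delta_mx 0 j).
  apply: Ck_on_sum => // j; apply: Ck_onZ => //; exact: Ck_on_cst.
by apply/funext => x; rewrite -row_sum_delta.
Qed.

Lemma Ck_on_det m k U (A : 'rV[R]_n -> 'M[R]_m) : open U ->
  (forall i j, Ck_on k U (fun x => A x i j)) -> Ck_on k U (fun x => \det (A x)).
Proof.
move=> Uo Ak; apply: Ck_on_sum => // s; apply: Ck_onM => //.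
  exact: Ck_on_cst.
exact: Ck_on_prod.
Qed.

(** Cramer's rule: the entries of the inverse are cofactors divided by a nowhere vanishing
    determinant. *)
Lemma Ck_on_invmx m k U (A : 'rV[R]_n -> 'M[R]_m) : open U ->
  (forall x, U x -> A x \in unitmx) ->
  (forall i j, Ck_on k U (fun x => A x i j)) ->
  forall i j, Ck_on k U (fun x => invmx (A x) i j).
Proof.
move=> Uo Au Ak i j.
apply: (@Ck_on_ext _ _ _ (fun x => (\det (A x))^-1 * cofactor (A x) j i)) => //.
  by move=> x /Au Ax; rewrite /invmx Ax !mxE.
apply: Ck_onM => //.
  apply: Ck_onV => //; last exact: Ck_on_det.
  by move=> x /Au; rewrite unitmxE unitfE.
apply: Ck_onM => //; first exact: Ck_on_cst.
apply: Ck_on_det => // i' j'.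
by under eq_fun do rewrite !mxE.
Qed.

End Ck.

Lemma Ck_on_comp (R : realType) n m (W : normedModType R) k (U : set 'rV[R]_n)
    (V : set 'rV[R]_m) (f : 'rV[R]_n -> 'rV[R]_m) (g : 'rV[R]_m -> W) :
  open U -> (forall x, U x -> V (f x)) ->
  Ck_on k U f -> Ck_on k V g -> Ck_on k U (g \o f).
Proof.
move=> Uo fUV; elim: k W g f fUV => [|k IH] W g f fUV fk gk.
  move=> x Ux; apply: continuous_comp; first exact: fk.
  by apply: gk; exact: fUV.
apply: (@Ck_onS _ _ _ _ _ _ (fun x => 'd g (f x) \o 'd f x)) => //.
  move=> x Ux; apply: is_diff_comp; first exact: Ck_on_is_diff fk Ux.
  exact: Ck_on_is_diff gk (fUV _ Ux).
(* The direction in which [g] is differentiated varies with [x]. Expanding it in the standard basis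
   leaves derivatives of [g] in fixed directions, composed with [f], to which the induction
   hypothesis applies. *)
move=> v; rewrite (_ : (fun x => _) = fun x =>
    \sum_j 'd f x v 0 j *: 'd g (f x) (delta_mx 0 j)); last first.
  by apply/funext => x /=; rewrite rV_linear_sum.
apply: Ck_on_sum => // j; apply: Ck_onZ => //.
  by apply: Ck_on_coord => //; apply fk.
apply: (IH W (fun x => 'd g x (delta_mx 0 j)) f) => //; last by apply gk.
exact: Ck_onW.
Qed.

(** * The inverse function theorem *)

Section inverse_function.
Variable R : realType.

Lemma rV_norm_leP n (v : 'rV[R]_n) (c : R) : 0 <= c ->
  `|v| <= c <-> forall j, `|v 0 j| <= c.
Proof.
move=> c0; rewrite [`|v|]mx_normrE; split=> [/bigmax_leP[_ H] j|H].
  exact: (H (0, j)).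
by apply/bigmax_leP; split=> // -[i j] _; rewrite ord1; exact: H.
Qed.

Lemma norm_mulmx_le m n (A : 'M[R]_(m, n)) (v : 'rV[R]_m) (c : R) : 0 <= c ->
  (forall i j, `|A i j| <= c) -> `|v *m A| <= m%:R * c * `|v|.
Proof.
move=> c0 Ac; apply/rV_norm_leP => [|j]; first by rewrite !mulr_ge0.
rewrite mxE (le_trans (ler_norm_sum _ _ _))//.
rewrite (le_trans (y := \sum_(i < m) c * `|v|))//.
  apply: ler_sum => i _; rewrite normrM mulrC ler_pM//.
  exact: (rV_norm_leP v _).1.
by rewrite sumr_const card_ord mulr_natl mulrnAl.
Qed.

(** The norm is the maximum of the coordinates, so the one-dimensional mean value theorem applied to
    each coordinate gives the bound without loss in the constant. *)
Lemma mean_value_rV m n (f : 'rV[R]_m -> 'rV[R]_n) x y (c : R) : 0 <= c ->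
  (forall t : R, 0 <= t <= 1 -> differentiable f (y + t *: (x - y)) /\
     `|'d f (y + t *: (x - y)) (x - y)| <= c) ->
  `|f x - f y| <= c.
Proof.
move=> c0 H; apply/rV_norm_leP => // j; rewrite !mxE.
pose p := fun t : R => y + t *: (x - y).
pose phi := fun t : R => f (p t) 0 j : R.
pose dphi := fun t : R => 'd f (p t) (x - y) 0 j : R.
have dp t : is_diff t p (fun s : R => s *: (x - y)).
  have := @is_diffD _ _ _ (cst y) (fun s : R => s *: (x - y)) _ _ t
    (is_diff_cst _ _) (is_diff_scalel _ _).
  by rewrite add0r.
have dphiP (t : R) : 0 <= t <= 1 -> is_diff t phi (fun s : R => 'd f (p t) (s *: (x - y)) 0 j).
  move=> /H[df _].
  have d1 : is_diff (p t) f ('d f (p t)) by split.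
  have d2 : is_diff (f (p t)) (@mx_coord R 1 n 0 j) (@mx_coord R 1 n 0 j).
    have cc : continuous (@mx_coord R 1 n 0 j) by exact: coord_continuous.
    by split; [exact: linear_differentiable|exact: diff_lin].
  have d3 := is_diff_comp (dp t) d1.
  exact: (@is_diff_comp _ _ _ _ _ _ _ _ _ d3 d2).
have dphiD (t : R) : 0 <= t <= 1 -> is_derive t 1 phi (dphi t).
  move=> /dphiP dt; split; first exact/diff_derivable/ex_diff.
  by rewrite deriveE ?diff_val ?scale1r//; exact: ex_diff.
have := @MVT_segment R phi dphi 0 1 ler01.
case.
- by move=> t; rewrite in_itv/= => /andP[/ltW t0 /ltW t1]; apply: dphiD; rewrite t0.
- apply: derivable_within_continuous => t; rewrite in_itv/= => /dphiD.
  by case.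
move=> t; rewrite in_itv/= => t01 E.
have -> : f x 0 j - f y 0 j = phi 1 - phi 0.
  by rewrite /phi /p scale1r scale0r addr0 subrKC.
rewrite E subr0 mulr1; have [_ Hc] := H t t01.
exact: (rV_norm_leP _ _).1.
Qed.

Definition jac n m (f : 'rV[R]_n -> 'rV[R]_m) x : 'M[R]_(n, m) := lin1_mx ('d f x).

Lemma mul_jac n m (f : 'rV[R]_n -> 'rV[R]_m) x v : v *m jac f x = 'd f x v.
Proof. by rewrite mul_rV_lin1. Qed.

Lemma near_ball_closed (V : normedModType R) (x : V) (P : set V) :
  (\forall y \near x, P y) ->
  exists2 r : R, 0 < r & forall y, `|y - x| <= r -> P y.
Proof.
move=> /nbhs_closedballP[r H]; exists (r%:num) => // y yx; apply: H.
by rewrite closed_ballE//= /closed_ball_ /= distrC.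
Qed.

Lemma near_all (T : topologicalType) (I : finType) (x : T) (P : I -> T -> Prop) :
  (forall i, \forall y \near x, P i y) -> \forall y \near x, forall i, P i y.
Proof.
by move=> H; apply: filter_forall.
Qed.

Lemma closed_norm_ball (V : normedModType R) (x : V) (r : R) :
  closed [set y | `|y - x| <= r].
Proof.
have -> : [set y | `|y - x| <= r] = (fun y => `|y - x|) @^-1` [set t | t <= r] by [].
apply: closed_comp; last exact: closed_le.
move=> y _; apply: (@continuous_comp _ _ _ (fun y => y - x) Num.norm).
  by apply: (@continuousB _ _ _ id (cst x)); [|exact: cst_continuous].
exact: norm_continuous.
Qed.

HB.instance Definition _ m n := Uniform_isComplete.Build 'M[R]_(m, n)
  (@mx_complete R m n).

Lemma contraction_fixed_point n (x0 : 'rV[R]_n) (r : R)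
    (T : 'rV[R]_n -> 'rV[R]_n) : 0 < r ->
  (forall x, `|x - x0| <= r -> `|T x - x0| <= r) ->
  (forall x y, `|x - x0| <= r -> `|y - x0| <= r ->
     `|T x - T y| <= 2^-1 * `|x - y|) ->
  exists2 p, `|p - x0| <= r & T p = p.
Proof.
move=> r0 Tr Tl; pose B := [set x : 'rV[R]_n | `|x - x0| <= r].
have TB : set_fun B B T by move=> x /Tr.
pose fM := isFun.Build _ _ _ _ _ TB.
pose f : {fun B >-> B} := HB.pack T fM.
have [|||p Bp E] := @banach_fixed_point R 'rV[R]_n B f.
- exists 2^-1%:nng; split => /=; first by rewrite invf_lt1// ltr1n.
  by move=> [x y] /= [Bx By]; exact: Tl.
- exact: closed_norm_ball.
- by exists x0; rewrite /B /= subrr normr0 ltW.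
by exists p.
Qed.

End inverse_function.

Lemma continuous_dist_lt (R : realType) (T : topologicalType)
    (V : normedModType R) (f : T -> V) x e : {for x, continuous f} -> 0 < e ->
  \forall y \near x, `|f x - f y| < e.
Proof. by move=> fx e0; exact: cvgr_dist_lt. Qed.

Lemma dist_lt_continuous (R : realType) (T : topologicalType)
    (V : normedModType R) (f : T -> V) x :
  (forall e, 0 < e -> \forall y \near x, `|f x - f y| < e) ->
  {for x, continuous f}.
Proof. by move=> fx; apply/cvgrPdist_lt. Qed.

Section local_inverse.
Variables (R : realType) (n : nat).
Implicit Types (U V : set 'rV[R]_n) (H G : 'rV[R]_n -> 'rV[R]_n).

Lemma near_jac_close U H x0 : open U -> U x0 -> Ck_on 1 U H ->
  (forall v, 'd H x0 v = v) ->
  exists2 r : R, 0 < r & forall x, `|x - x0| <= r ->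
    U x /\ forall v, `|v - 'd H x v| <= 2^-1 * `|v|.
Proof.
move=> Uo Ux0 [dH cH] dHid.
(* Entries bounded by [c] give [|v *m B| <= n * c * |v|], which is at most [|v| / 2]; the successor
   keeps [c] positive when [n = 0]. *)
pose c : R := (2 * n.+1%:R)^-1.
have c0 : 0 < c by rewrite invr_gt0 mulr_gt0.
pose P (ij : 'I_n * 'I_n) x := `|(1%:M - jac H x) ij.1 ij.2| < c.
have nP : \forall x \near x0, forall ij, P ij x.
  apply: near_all => -[i j].
  have cf : {for x0, continuous (fun x => 'd H x (delta_mx 0 i) 0 j)}.
    apply: (@continuous_comp _ _ _ (fun x => 'd H x (delta_mx 0 i))
      (fun v : 'rV[R]_n => v 0 j)).
      exact: cH.
    exact: coord_continuous.
  have E0 : 'd H x0 (delta_mx 0 i) 0 j = (i == j)%:R.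
    by rewrite dHid mxE eqxx eq_sym.
  have E x : (1%:M - jac H x) i j = (i == j)%:R - 'd H x (delta_mx 0 i) 0 j.
    by rewrite mxE [_%:M i j]mxE [X in _ + X]mxE [jac H x i j]mxE.
  have N := continuous_dist_lt cf c0.
  by apply: filterS N => x; rewrite /P /= E -E0.
have nU : \forall x \near x0, U x by exact: open_nbhs_nbhs (conj Uo Ux0).
have [r r0 Hr] := near_ball_closed (filterI nU nP).
exists r => // x /Hr[Ux Px]; split=> // v.
have -> : v - 'd H x v = v *m (1%:M - jac H x).
  by rewrite mulmxBr mulmx1 mul_jac.
apply: (le_trans (norm_mulmx_le v (ltW c0) _)) => [i j|]; first exact/ltW/(Px (i, j)).
apply: ler_wpM2r => //; rewrite /c invfM mulrCA ler_piMr ?invr_ge0//.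
by rewrite ler_pdivrMr// mul1r ler_nat.
Qed.

Lemma jac_unit H x : (forall v, `|v - 'd H x v| <= 2^-1 * `|v|) ->
  jac H x \in unitmx.
Proof.
move=> Hx; rewrite -row_free_unit; apply/inj_row_free => v.
rewrite mul_jac => v0; have := Hx v; rewrite v0 subr0 => vv.
by apply/eqP; rewrite -normr_le0; lra.
Qed.

(** With the differential normalised to the identity, [x - H x] is a contraction of factor 1/2 near
    [x0], and solving [H z = y] means finding a fixed point of [z |-> z - H z + y]. *)
Lemma local_inverse U H x0 : open U -> U x0 -> smooth_on U H ->
  (forall v, 'd H x0 v = v) ->
  exists V G, [/\ open V, V (H x0), smooth_on V G,
    \forall x \near x0, G (H x) = x &
    forall y, V y -> U (G y) /\ H (G y) = y].
Proof.
move=> Uo Ux0 Hs dHid.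
have [r r0 Hr] := near_jac_close Uo Ux0 (Hs 1) dHid.
have dH x : U x -> differentiable H x by move=> Ux; apply (Hs 1).
pose g x := x - H x.
have gl x y : `|x - x0| <= r -> `|y - x0| <= r ->
    `|g x - g y| <= 2^-1 * `|x - y|.
  move=> xr yr; apply: mean_value_rV => [|t /andP[t0 t1]]; first by rewrite mulr_ge0.
  have tr : `|y + t *: (x - y) - x0| <= r.
    have -> : y + t *: (x - y) - x0 = t *: (x - x0) + (1 - t) *: (y - x0).
      by apply/rowP => j; rewrite !mxE; ring.
    rewrite (le_trans (ler_normD _ _))// !normrZ !ger0_norm ?subr_ge0//.
    have : t * `|x - x0| <= t * r by exact: ler_wpM2l.
    have : (1 - t) * `|y - x0| <= (1 - t) * r by apply: ler_wpM2l; rewrite ?subr_ge0.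
    lra.
  have [Ut Ht] := Hr _ tr.
  have dg : is_diff (y + t *: (x - y)) g (fun v => v - 'd H (y + t *: (x - y)) v).
    apply: (@is_diffB _ _ _ id H id ('d H (y + t *: (x - y)))).
    by split => //; exact: dH.
  split; first exact: ex_diff.
  by rewrite diff_val; exact: Ht.
have inj x y : `|x - x0| <= r -> `|y - x0| <= r -> `|x - y| <= 2 * `|H x - H y|.
  move=> xr yr; have := gl _ _ xr yr.
  have : `|x - y| <= `|g x - g y| + `|H x - H y|.
    apply: le_trans (ler_normD _ _).
    rewrite le_eqVlt; apply/orP; left; apply/eqP; congr (`| _ |).
    by apply/rowP => j; rewrite /g !mxE; ring.
  lra.
(* The radius [r / 2] keeps the closed ball of radius [r] invariant, as the contraction contributes
   another [r / 2]. The implication stands inside the existential, with junk value 0, so that choice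
   yields a total function [G]. *)
have ex y : exists z, `|y - H x0| < r / 2 -> `|z - x0| < r /\ H z = y.
  have [yr|] := pselect (`|y - H x0| < r / 2); last by exists 0.
  have [||p pr Tp] := @contraction_fixed_point R n x0 r (fun z => g z + y) r0.
  - move=> z zr.
    have x0r : `|x0 - x0| <= r by rewrite subrr normr0 ltW.
    have := gl _ _ zr x0r.
    have : `|g z + y - x0| <= `|g z - g x0| + `|y - H x0|.
      apply: le_trans (ler_normD _ _).
      rewrite le_eqVlt; apply/orP; left; apply/eqP; congr (`| _ |).
    by apply/rowP => j; rewrite /g !mxE; ring.
    lra.
  - move=> z z' zr zr'; have -> : g z + y - (g z' + y) = g z - g z'.
      by apply/rowP => j; rewrite !mxE; ring.
    exact: gl.
  exists p => _.
  have Hp : H p = y.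
    by move: Tp => /rowP Tp; apply/rowP => j; have := Tp j; rewrite /g !mxE; lra.
  have x0r : `|x0 - x0| <= r by rewrite subrr normr0 ltW.
  split=> //; apply: le_lt_trans (inj _ _ pr x0r) _; rewrite Hp; lra.
have [G HG] := choice ex.
pose V := [set y : 'rV[R]_n | `|y - H x0| < r / 2].
have Vo : open V.
  rewrite (_ : V = ball (H x0) (r / 2)); first exact: ball_open.
  by apply/seteqP; split=> y; rewrite /V -ball_normE /= distrC.
have VH : V (H x0) by rewrite /V /= subrr normr0 divr_gt0.
have GU y : V y -> U (G y) by move=> /HG[/ltW/Hr[]].
have Gl y y' : V y -> V y' -> `|G y - G y'| <= 2 * `|y - y'|.
  move=> /HG[/ltW yr Hy] /HG[/ltW yr' Hy']; rewrite -{2}Hy -{2}Hy'; exact: inj.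
have Ju y : V y -> jac H (G y) \in unitmx.
  by move=> /HG[/ltW/Hr[_ ?] _]; exact: jac_unit.
pose L y : {linear 'rV[R]_n -> 'rV[R]_n} := mulmxr (invmx (jac H (G y))).
have dG y : V y -> is_diff y G (L y).
  move=> Vy; have Lc : continuous (L y) by exact: rV_linear_continuous.
  apply/is_diffP; split=> // e e0.
  have [k k0 Lk] := linear_lipschitz Lc.
  have nV : \forall y' \near y, V y' by exact: open_nbhs_nbhs (conj Vo Vy).
  have Gc : {for y, continuous G}.
    apply: (@dist_lt_continuous R) => e' e'0.
    have : \forall y' \near y, `|y - y'| < e' / 2.
      apply: (@continuous_dist_lt R 'rV[R]_n 'rV[R]_n id) => //.
      by rewrite divr_gt0.
    apply: filterS2 nV => y' Vy' yy'; apply: le_lt_trans (Gl _ _ Vy Vy') _; lra.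
  have dHG : is_diff (G y) H ('d H (G y)) by split => //; exact/dH/GU.
  (* The remainder of [G] at [y] is [- L y] applied to the remainder of [H] at [G y]; in [2 * k],
     [k] is a Lipschitz constant of [L y] and 2 one of [G]. *)
  pose e1 := e / (2 * k).
  have e10 : 0 < e1 by rewrite divr_gt0 ?mulr_gt0.
  have := (is_diffP _ _ _).1 dHG => -[_ /(_ _ e10)/Gc].
  rewrite near_simpl.
  apply: filterS2 nV => y' Vy' Hy'.
  have -> : G y' - G y - L y (y' - y) =
      - L y (H (G y') - H (G y) - 'd H (G y) (G y' - G y)).
    have LJ w : L y ('d H (G y) w) = w.
      by rewrite -mul_jac /L /= mulmxK// Ju.
    rewrite (HG _ Vy').2 (HG _ Vy).2.
    by rewrite (linearB (L y) _ ('d H (G y) _)) LJ opprB.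
  rewrite normrN (le_trans (Lk _))//.
  have := Gl _ _ Vy' Vy => GG.
  have {}Hy' := le_trans Hy' (ler_wpM2l (ltW e10) GG).
  apply: (le_trans (ler_wpM2l (ltW k0) Hy')).
  by rewrite /e1 le_eqVlt; apply/orP; left; apply/eqP; field; rewrite gt_eqF.
exists V, G; split => //.
(* Bootstrap: the differential of [G] is the inverse Jacobian of [H] taken along [G], so it is as
   regular as [G], which gains one order. *)
- move=> k; elim: k => [|k IH].
    by move=> y /dG dy; apply: differentiable_continuous; exact: ex_diff.
  apply: (@Ck_onS _ _ _ _ _ _ (fun y => L y)) => // v.
  apply: Ck_on_row => // j.
  rewrite (_ : (fun=> _) = fun y => \sum_i v 0 i * invmx (jac H (G y)) i j); last first.
    by apply/funext => y; rewrite /L /= mxE.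
  apply: Ck_on_sum => // i; apply: Ck_onM => //; first exact: Ck_on_cst.
  apply: Ck_on_invmx => // i' j'.
  under eq_fun do rewrite mxE.
  apply: (@Ck_on_coord _ _ _ _ _ (fun y => 'd H (G y) (delta_mx 0 i'))) => //.
  apply: (@Ck_on_comp _ _ _ _ _ _ U G (fun x => 'd H x (delta_mx 0 i'))) => //.
  by apply (Hs k.+1).
- have Hc : {for x0, continuous H} by exact: differentiable_continuous (dH _ Ux0).
  have nV : \forall x \near x0, V (H x).
    by apply: Hc; exact: open_nbhs_nbhs (conj Vo VH).
  have nr : \forall x \near x0, `|x - x0| <= r.
    have := continuous_dist_lt (f := @id 'rV[R]_n) (x := x0) (@cvg_id _ _) r0.
    by apply: filterS => x /ltW; rewrite distrC.
  apply: filterS2 nV nr => x /HG[/ltW Gr HGx] xr.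
  have := inj _ _ Gr xr; rewrite HGx subrr normr0 mulr0 normr_le0 subr_eq0.
  by move/eqP.
- by move=> y Vy; split; [exact: GU|exact: (HG _ Vy).2].
Qed.

End local_inverse.

(* [H x = (h x - h x0) A + (x - x0) (1 - D A)], with [A] a right inverse of
   [D = dh(x0)], has differential the identity at [x0] and [H x D = h x - h x0]. *)
Lemma submersion_normal_form (R : realType) n m (U : set 'rV[R]_n)
    (h : 'rV[R]_n -> 'rV[R]_m) x0 : open U -> U x0 -> smooth_on U h ->
  (forall w, exists v, 'd h x0 v = w) ->
  exists (A : 'M[R]_(m, n)) (V : set 'rV[R]_n) (G : 'rV[R]_n -> 'rV[R]_n),
  [/\ open V, V 0, smooth_on V G,
    \forall x \near x0,
      G ((h x - h x0) *m A + ((x - x0) - 'd h x0 (x - x0) *m A)) = x &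
  [/\ G 0 = x0, forall v, 'd G 0 v = v, forall w, 'd h x0 (w *m A) = w &
      forall y, V y -> U (G y) /\ h (G y) = h x0 + 'd h x0 y]].
Proof.
move=> Uo Ux0 hs hsurj.
have [a ha] := choice hsurj.
pose A : 'M[R]_(m, n) := \matrix_i a (delta_mx 0 i).
pose D := jac h x0.
have AD : A *m D = 1%:M.
  apply/row_matrixP => i; rewrite row_mul rowK mul_jac ha row1.
  by [].
pose H x := (h x - h x0) *m A + (x - x0) *m (1%:M - D *m A).
have dh : is_diff x0 h ('d h x0).
  by split => //; apply (hs 1).
have dH : is_diff x0 H (fun v => 'd h x0 v *m A + v *m (1%:M - D *m A)).
  have dm p (B : 'M[R]_(p, n)) z : is_diff z (mulmxr B : 'rV_p -> 'rV_n) (mulmxr B).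
    have Bc : continuous (mulmxr B : 'rV_p -> 'rV_n) by exact: rV_linear_continuous.
    by split; [exact: linear_differentiable|exact: diff_lin].
  have d1 : is_diff x0 (fun x => h x - h x0) ('d h x0).
    have := is_diffB dh (is_diff_cst (h x0) x0).
    by rewrite subr0.
  have d2 : is_diff x0 (fun x => x - x0) id.
    have := is_diffB (is_diff_id x0) (is_diff_cst x0 x0).
    by rewrite subr0.
  have e1 := is_diff_comp d1 (dm _ A _).
  have e2 := is_diff_comp d2 (dm _ (1%:M - D *m A) _).
  exact: is_diffD e1 e2.
have dHid v : 'd H x0 v = v.
  have -> : 'd H x0 v = 'd h x0 v *m A + v *m (1%:M - D *m A).
    by have [_ ->] := dH.
  by rewrite mulmxBr mulmx1 mulmxA mul_jac addrC subrK.
have Hx0 : H x0 = 0 by rewrite /H !subrr !mul0mx addr0.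
have HD x : H x *m D = h x - h x0.
  rewrite /H mulmxDl -mulmxA AD mulmx1 -[X in _ + X]mulmxA.
  rewrite [(1%:M - _) *m D]mulmxBl mul1mx.
  by rewrite -(mulmxA D A D) AD mulmx1 subrr mulmx0 addr0.
have Hs : smooth_on U H.
  move=> k; apply: Ck_onD => //.
    apply: (@Ck_on_linear_comp _ _ _ _ _ _ (mulmxr A) (fun x => h x - h x0)) => //.
      exact: rV_linear_continuous.
    by apply: Ck_onD => //; exact: Ck_on_cst.
  apply: (@Ck_on_linear_comp _ _ _ _ _ _ (mulmxr (1%:M - D *m A)) (fun x => x - x0)) => //.
    exact: rV_linear_continuous.
  by apply: Ck_onD => //; [exact: (Ck_on_linear _ _ idfun)|exact: Ck_on_cst].
have [V [G [Vo V0 Gs nG HG]]] := local_inverse Uo Ux0 Hs dHid.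
have G0 : G 0 = x0 by rewrite -Hx0; exact: nbhs_singleton nG.
rewrite Hx0 in V0.
exists A, V, G; split; [exact: Vo|exact: V0|exact: Gs| |split].
- apply: filterS nG => x; rewrite /H mulmxBr mulmx1 mulmxA (mul_jac h).
  exact: id.
- exact: G0.
- move=> v; have dG : is_diff 0 G ('d G 0) by split => //; apply (Gs 1).
  have dH' : is_diff (G 0) H ('d H x0).
    by rewrite G0; split => //; exact: ex_diff.
  have dHG := is_diff_comp dG dH'.
  have nV : \forall y \near (0 : 'rV[R]_n), V y by exact: open_nbhs_nbhs (conj Vo V0).
  have nid : \forall y \near (0 : 'rV[R]_n), y = (H \o G) y.
    by apply: filterS nV => y /HG[_ Hy]; rewrite /= Hy.
  have [_ E] := near_eq_is_diff nid (is_diff_id _).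
  have [_ E'] := dHG.
  have E1 : 'd (H \o G) 0 v = v := congr1 (@^~ v) E.
  have E2 : 'd (H \o G) 0 v = 'd H x0 ('d G 0 v) := congr1 (@^~ v) E'.
  exact: etrans (esym (dHid _)) (etrans (esym E2) E1).
- by move=> w; rewrite -(mul_jac h) -mulmxA AD mulmx1.
- move=> y /HG[UG Hy]; split=> //.
  by rewrite -(mul_jac h) -/D -{2}Hy HD addrC subrK.
Qed.

(** * Smooth maps in charts *)

Lemma open_setI_preimage (T S : topologicalType) (A : set T) (f : T -> S)
    (B : set S) : open A -> (forall x, A x -> {for x, continuous f}) -> open B ->
  open (A `&` f @^-1` B).
Proof.
move=> Ao fc Bo; rewrite openE => x [Ax Bfx].
apply: filterI; first exact: open_nbhs_nbhs (conj Ao Ax).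
by apply: (fc x Ax); exact: open_nbhs_nbhs (conj Bo Bfx).
Qed.

Section charts.
Variable R : realType.
Implicit Types M N P : manifold R.

(** Folded form of the domain in [smooth], as [loc] is of the chart expression there. Both charts
    are free parameters; [mdiff f x] is the differential of [loc f x (f x)]. *)
Definition locdom M N (f : M -> N) (a : M) (b : N) : set 'rV[R]_(mdim M) :=
  ccod (chart_at a) `&` (f \o cinv (chart_at a)) @^-1` cdom (chart_at b).

Definition loc M N (f : M -> N) (a : M) (b : N) :=
  cfun (chart_at b) \o f \o cinv (chart_at a).

Lemma locdom_open M N (f : M -> N) a b : continuous f -> open (locdom f a b).
Proof.
move=> fc; apply: open_setI_preimage; first exact: ccod_open.
- move=> x ax; apply: continuous_comp; last exact: fc.
  exact: cinv_continuous.
- exact: cdom_open.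
Qed.

Lemma smooth_loc M N (f : M -> N) a b :
  smooth f -> smooth_on (locdom f a b) (loc f a b).
Proof. by case=> _; exact. Qed.

Lemma loc_diff M N (f : M -> N) a b y : smooth f -> locdom f a b y ->
  is_diff y (loc f a b) ('d (loc f a b) y).
Proof. by move=> /(@smooth_loc _ _ f a b)/(_ 1) fs fy; exact: Ck_on_is_diff fs fy. Qed.

(** Chart changes are the local expressions of the identity. Compatibility of the atlas is thus the
    smoothness of [id], and coordinate changes are written [loc id a b] from here on. *)
Lemma smooth_id M : smooth (@id M).
Proof.
split; first by move=> x; exact: cvg_id.
exact: chart_at_compat.
Qed.

Lemma cfun_locdom M N (f : M -> N) x : locdom f x (f x) (cfun (chart_at x) x).
Proof.
have xd := chart_at_dom x.
by split; [exact: cfunS|rewrite /= cfunK//; exact: chart_at_dom].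
Qed.

Lemma loc_cfun M N (f : M -> N) x :
  loc f x (f x) (cfun (chart_at x) x) = cfun (chart_at (f x)) (f x).
Proof. by rewrite /loc /= cfunK//; exact: chart_at_dom. Qed.

Lemma near_loc_comp M N P (f : M -> N) (g : N -> P) a b c y :
  continuous f -> locdom f a b y ->
  \forall z \near y, (loc g b c \o loc f a b) z = loc (g \o f) a c z.
Proof.
move=> fc fy; have Do := @locdom_open _ _ f a b fc.
apply: filterS (open_nbhs_nbhs (conj Do fy)) => z [_ /= fz].
by rewrite /loc /= cfunK.
Qed.

Lemma loc_comp_diff M N P (f : M -> N) (g : N -> P) a b c y v :
  smooth f -> smooth g -> locdom f a b y -> locdom g b c (loc f a b y) ->
  'd (loc (g \o f) a c) y v = 'd (loc g b c) (loc f a b y) ('d (loc f a b) y v).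
Proof.
move=> fs gs fy gy; have df := loc_diff fs fy; have dg := loc_diff gs gy.
have dgf := is_diff_comp df dg.
by have [_ ->] := near_eq_is_diff (near_loc_comp g c (fs.1) fy) dgf.
Qed.

Lemma loc_comp_locdom M N P (f : M -> N) (g : N -> P) a b c y :
  locdom f a b y -> locdom (g \o f) a c y -> locdom g b c (loc f a b y).
Proof.
move=> [ay /= fy] [_ /= gy]; split; first exact: cfunS.
by rewrite /loc /= cfunK.
Qed.

Lemma mdiff_comp M N P (f : M -> N) (g : N -> P) x v :
  smooth f -> smooth g ->
  mdiff (g \o f) x v = mdiff g (f x) (mdiff f x v).
Proof.
move=> fs gs; rewrite /mdiff -/(loc f x (f x)) -/(loc g (f x) (g (f x))).
rewrite -(loc_cfun f); apply: loc_comp_diff => //; first exact: cfun_locdom.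
by rewrite loc_cfun; exact: cfun_locdom.
Qed.

Lemma mdiff_id M x v : mdiff (@id M) x v = v.
Proof.
have xd := chart_at_dom x.
have nid : \forall z \near cfun (chart_at x) x, z = loc id x x z.
  have := open_nbhs_nbhs (conj (@ccod_open _ _ _ (chart_at x)) (cfunS xd)).
  by apply: filterS => z zx; rewrite /loc /= cinvK.
have [_ E] := near_eq_is_diff nid (is_diff_id _).
have E1 : 'd (loc id x x) (cfun (chart_at x) x) v = v := congr1 (@^~ v) E.
exact: E1.
Qed.

Lemma smooth_comp M N P (f : M -> N) (g : N -> P) :
  smooth f -> smooth g -> smooth (g \o f).
Proof.
move=> fs gs; split=> [x|a c].
  by apply: continuous_comp; [exact: fs.1|exact: gs.1].
move=> k; apply: Ck_on_local => y gfy.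
(* The intermediate chart is the one at the image of the point under consideration; it may vary with
   the point since [Ck_on] is checked locally. *)
pose b := f (cinv (chart_at a) y).
have fy : locdom f a b y by split; [exact: gfy.1|exact: chart_at_dom].
pose V := locdom f a b `&` loc f a b @^-1` locdom g b c.
have Vo : open V.
  apply: open_setI_preimage.
  - exact: locdom_open fs.1.
  - by move=> z /(loc_diff fs)[dz _]; exact: differentiable_continuous dz.
  - exact: locdom_open gs.1.
exists V; first by split => //; exact: loc_comp_locdom fy gfy.
apply: (@Ck_on_ext _ _ _ _ _ (loc g b c \o loc f a b)) => //.
  by move=> z [[_ /= fz] _]; rewrite /loc /= cfunK.
apply: (@Ck_on_comp _ _ _ _ _ _ (locdom g b c)) => //.
- by move=> z [].
- by apply: Ck_on_sub (@smooth_loc _ _ f a b fs k) => z [].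
- exact: smooth_loc gs k.
Qed.

(* The isomorphism from chart coordinates at [a] to the coordinates of the
   tangent space at [cinv a y], as it appears in [is_form]. *)
Definition chart_tangent M (a : M) (y v : 'rV[R]_(mdim M)) : 'rV[R]_(mdim M) :=
  'd (cfun (chart_at (cinv (chart_at a) y)) \o cinv (chart_at a)) y v.

Lemma chart_tangentE M (a : M) y x v : cinv (chart_at a) y = x ->
  chart_tangent a y v = 'd (loc id a x) y v.
Proof. by move=> <-. Qed.

Lemma chart_tangent_cfun M (x : M) v :
  chart_tangent x (cfun (chart_at x) x) v = v.
Proof.
rewrite (@chart_tangentE _ _ _ x); last by rewrite cfunK//; exact: chart_at_dom.
exact: mdiff_id.
Qed.

Lemma locdom_id M (a : M) y : ccod (chart_at a) y ->
  locdom id a (cinv (chart_at a) y) y.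
Proof. by move=> ay; split => //; exact: chart_at_dom. Qed.

Lemma loc_idE M (a : M) y x : cinv (chart_at a) y = x ->
  loc id a x y = cfun (chart_at x) x.
Proof. by rewrite /loc /= => ->. Qed.

(** Both sides compute the differential of [loc f a (f x)], factored once through the chart change
    at the source and once through the one at the target. This trades the charts of [mdiff], which
    jump from point to point, for the fixed charts in which smoothness is stated. *)
Lemma mdiff_chart_tangent M N (f : M -> N) a b y v : smooth f ->
  locdom f a b y ->
  mdiff f (cinv (chart_at a) y) (chart_tangent a y v) =
  chart_tangent b (loc f a b y) ('d (loc f a b) y v).
Proof.
move=> fs fy; set x := cinv (chart_at a) y.
have ax : locdom id a x y by exact: locdom_id fy.1.
have bx : cinv (chart_at b) (loc f a b y) = f x by rewrite /loc /= cfunK//; exact: fy.2.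
have Ey : loc id a x y = cfun (chart_at x) x by exact: loc_idE.
have fx : locdom f x (f x) (loc id a x y) by rewrite Ey; exact: cfun_locdom.
have fb : locdom id b (f x) (loc f a b y).
  apply: (@loc_comp_locdom _ _ _ f id a b) => //.
  by split; [exact: fy.1|exact: chart_at_dom].
have E1 := loc_comp_diff v (@smooth_id M) fs ax fx.
have E2 := loc_comp_diff v fs (@smooth_id N) fy fb.
rewrite (_ : loc (id \o f) a (f x) = loc (f \o id) a (f x)) in E2; last by [].
rewrite (chart_tangentE _ bx) (@chart_tangentE _ _ _ x _ erefl).
rewrite /mdiff -/(loc f x (f x)) -Ey.
exact: etrans (esym E1) E2.
Qed.

Lemma loc_idK M (a b : M) y v : locdom id a b y ->
  'd (loc id b a) (loc id a b y) ('d (loc id a b) y v) = v.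
Proof.
move=> ay; have by_ : locdom id b a (loc id a b y).
  by apply: (@loc_comp_locdom _ _ _ id id a b a) => //; split; [|apply: cinvS]; exact: ay.1.
have E1 := loc_comp_diff v (@smooth_id M) (@smooth_id M) ay by_.
have nid : \forall z \near y, z = loc (id \o id) a a z.
  have := open_nbhs_nbhs (conj (@ccod_open _ _ _ (chart_at a)) ay.1).
  by apply: filterS => z zx; rewrite /loc /= cinvK.
have [_ E] := near_eq_is_diff nid (is_diff_id _).
have E2 : 'd (loc (id \o id) a a) y v = v := congr1 (@^~ v) E.
exact: etrans (esym E1) E2.
Qed.

Fact mdiff_linear M N (f : M -> N) x : linear (mdiff f x).
Proof. by move=> a u v; rewrite /mdiff linearP. Qed.

HB.instance Definition _ M N (f : M -> N) x :=
  GRing.isLinear.Build _ _ _ _ _ (mdiff_linear f x).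

Fact chart_tangent_linear M (a : M) y : linear (chart_tangent a y).
Proof. by move=> c u v; rewrite /chart_tangent linearP. Qed.

HB.instance Definition _ M (a : M) y :=
  GRing.isLinear.Build _ _ _ _ _ (chart_tangent_linear a y).

End charts.

(** * Euclidean space as a manifold, and globalisation of germs *)

Section euclidean_space.
Variables (R : realType) (k : nat).

Lemma rV_second_countable : @second_countable 'rV[R]_k.
Proof.
pose f (qn : 'rV[rat]_k * nat) : set 'rV[R]_k :=
  ball (map_mx ratr qn.1 : 'rV[R]_k) (qn.2.+1%:R^-1).
exists (range f); first exact: card_le_trans (card_image_le _ _) (countableP _).
split=> [_ [qn _ <-]|x V /nbhs_ballP[_/posnumP[e] eV]].
  exact: ball_open.
have [//|N] := @ltr_add_invr R 0%R (e%:num/2) _; rewrite add0r => Ne.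
have N0 : (0 : R) < N.+1%:R^-1 by rewrite invr_gt0.
have qx j : exists q : rat, ball (ratr q : R) N.+1%:R^-1 (x 0 j).
  have xN : x 0 j < x 0 j + N.+1%:R^-1 by rewrite ltrDl.
  have [q] := rat_in_itvoo xN; rewrite in_itv/= => /andP[xq qx].
  by exists q; rewrite /ball /= ltr_distl qx andbT ltrBlDr (lt_trans xq)// ltrDl.
have [q {}qx] := choice qx.
have xq : f (\row_j q j, N) x by split=> // i j; rewrite !ord1 !mxE; exact: qx.
exists (f (\row_j q j, N)); first by split => //; exists (\row_j q j, N).
move=> z /= zf; apply: eV; rewrite [_%:num]splitr.
apply: (@ball_triangle _ _ (map_mx ratr (\row_j q j) : 'rV[R]_k) x z).
  by apply: (le_ball (ltW Ne)); exact/ball_sym.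
exact: (le_ball (ltW Ne)).
Qed.

Definition id_chart : chart R 'rV[R]_k k :=
  @Chart R 'rV[R]_k k setT setT id id openT openT
    (fun _ _ => I) (fun _ _ => I) (fun _ _ => erefl) (fun _ _ => erefl)
    (fun x _ => @cvg_id _ (nbhs x)) (fun x _ => @cvg_id _ (nbhs x)).

Fact id_chart_compat (x y : 'rV[R]_k) :
  smooth_on (ccod id_chart `&` cinv id_chart @^-1` cdom id_chart)
    (cfun id_chart \o cinv id_chart).
Proof. by move=> l; exact: (Ck_on_linear _ _ (idfun : {linear 'rV[R]_k -> 'rV[R]_k})). Qed.

Definition euclid : manifold R :=
  @Manifold R 'rV[R]_k k (fun=> id_chart) (@norm_hausdorff _ _)
    rV_second_countable (fun _ => I) id_chart_compat.

Definition origin : euclid := (0 : 'rV[R]_k).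

Lemma smooth_chart_map (M : manifold R) (a : M) (u : 'rV[R]_k -> 'rV[R]_(mdim M)) :
  smooth_on setT u -> (forall t, ccod (chart_at a) (u t)) ->
  smooth (cinv (chart_at a) \o u : euclid -> M) /\
  forall v, mdiff (cinv (chart_at a) \o u : euclid -> M) origin v =
    chart_tangent a (u 0) ('d u (0 : 'rV[R]_k) v).
Proof.
move=> us ua; have uc : forall t, {for t, continuous u} by move=> t; exact: (us 0).
have cuc t : {for t, continuous (cinv (chart_at a) \o u)}.
  apply: (@continuous_comp 'rV[R]_k 'rV[R]_(mdim M) _ u (cinv (chart_at a)) t).
    exact: uc.
  exact: cinv_continuous.
have H : smooth (cinv (chart_at a) \o u : euclid -> M).
  split=> [t|t b l]; first exact: cuc.
  apply: (@Ck_on_comp _ _ _ _ _ _ (locdom id a b) u (loc id a b)).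
  - apply: open_setI_preimage; first exact: openT.
      by move=> s _; exact: cuc.
    exact: cdom_open.
  - by move=> s [_ sb]; split.
  - by apply: Ck_on_sub (us l).
  - by apply: smooth_loc; exact: smooth_id.
split=> // v.
set x := cinv (chart_at a) (u 0).
have ax : locdom id a x (u 0) by exact: locdom_id.
have dx := loc_diff (@smooth_id _ M) ax.
have du : is_diff (0 : 'rV[R]_k) u ('d u (0 : 'rV[R]_k)).
  by split => //; apply (us 1).
have [_ E] := is_diff_comp du dx.
have E1 : 'd (loc id a x \o u) (0 : 'rV[R]_k) v =
  'd (loc id a x) (u 0) ('d u (0 : 'rV[R]_k) v) := congr1 (@^~ _) E.
exact: E1.
Qed.

(* Precomposing with a bounded [phi] turns a germ at the origin into a map
   defined on the whole space, without changing its differential there. *)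
Definition is_reparam (phi : euclid -> euclid) :=
  [/\ smooth phi, phi origin = origin & forall v, mdiff phi origin v = v].

Lemma smooth_on_euclid (phi : euclid -> euclid) : smooth phi ->
  smooth_on setT (phi : 'rV[R]_k -> 'rV[R]_k).
Proof. by case=> _ + l => /(_ origin origin l); apply: Ck_on_sub => t _; split. Qed.

Lemma reparam_exists (e : R) : 0 < e -> exists phi : euclid -> euclid,
  is_reparam phi /\ forall t, `|phi t : 'rV[R]_k| < e.
Proof.
move=> e0.
(* The map is [t / d t], a rational substitute for a cut-off. As [d 0 = 1] and the Leibniz term that
   differentiates [1 / d] is multiplied by [t = 0], its differential at 0 is the identity; the
   quadratic growth of [d] bounds it by [e]. *)
pose d (t : 'rV[R]_k) : R := 1 + \sum_j (t 0 j / e) * (t 0 j / e).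
have dj (t : 'rV[R]_k) j : 1 + (t 0 j / e) * (t 0 j / e) <= d t.
  rewrite lerD2l (bigD1 j)//= lerDl sumr_ge0// => i _.
  by rewrite -expr2 sqr_ge0.
have d1 t : 0 < d t.
  by rewrite ltr_pwDl// sumr_ge0// => i _; rewrite -expr2 sqr_ge0.
have d0 t : d t != 0 by rewrite gt_eqF.
pose phi (t : 'rV[R]_k) : 'rV[R]_k := (d t)^-1 *: t.
have ds l : Ck_on l setT d.
  apply: Ck_onD; [exact: openT|exact: Ck_on_cst|].
  apply: Ck_on_sum => [|j]; first exact: openT.
  have tl : Ck_on l setT (fun t : 'rV[R]_k => t 0 j / e).
    apply: Ck_onM; [exact: openT| |exact: Ck_on_cst].
    apply: (@Ck_on_coord _ _ _ _ _ id) => //; first exact: openT.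
    exact: (Ck_on_linear _ _ idfun).
  by apply: Ck_onM => //; exact: openT.
have phis : smooth_on setT phi.
  move=> l; apply: Ck_onZ => //; first exact: openT.
    by apply: Ck_onV => //; exact: openT.
  exact: (Ck_on_linear _ _ idfun).
have phi0 : phi 0 = 0 by rewrite /phi scaler0.
have dphi v : 'd phi (0 : 'rV[R]_k) v = v.
  have dd : is_diff (0 : 'rV[R]_k) (fun t => (d t)^-1) ('d (fun t => (d t)^-1) (0 : 'rV[R]_k)).
    split => //; have Vk : Ck_on 1 setT (fun t => (d t)^-1).
      by apply: Ck_onV => //; exact: openT.
    by apply Vk.
  have [_ E] := is_diff_scale dd (is_diff_id _).
  have := congr1 (@^~ v) E; rewrite /= scaler0 add0r => ->.
  rewrite /d big1 ?addr0 ?invr1 ?scale1r// => j _.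
  by rewrite mxE mul0r mul0r.
exists phi; split.
- split; last exact: dphi.
  + split; first by move=> t; exact: (phis 0).
    by move=> x y l; apply: Ck_on_sub (phis l).
  + exact: phi0.
- move=> t; rewrite /phi normrZ normfV gtr0_norm//.
  rewrite mulrC ltr_pdivrMr//.
  have [->|t0] := eqVneq (`|t|) 0; first by rewrite mulr_gt0.
  rewrite [`|t|]mx_normrE (@bigmax_lt _ R)// => [|[i j] _]; first by rewrite mulr_gt0.
  rewrite ord1 /=; apply: lt_le_trans (ler_wpM2l (ltW e0) (dj t j)).
  have -> : e * (1 + (t 0 j / e) * (t 0 j / e)) = e + `|t 0 j| * `|t 0 j| / e.
    by rewrite -normrM ger0_norm -?expr2 ?sqr_ge0//; field; rewrite gt_eqF.
  set s := `|t 0 j|.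
  (* Completing the square in [s ^+ 2 - e * s + e ^+ 2], which is therefore positive. *)
  have -> : e + s * s / e = s + ((s - e / 2) ^+ 2 + 3 / 4 * e ^+ 2) / e.
    by field; rewrite gt_eqF.
  rewrite ltrDl divr_gt0//.
  have : 0 <= (s - e / 2) ^+ 2 by exact: sqr_ge0.
  have : 0 < e ^+ 2 by rewrite exprn_gt0.
  lra.
Qed.

Lemma smooth_germ_map (M : manifold R) (a : M) (W : set 'rV[R]_k)
    (u : 'rV[R]_k -> 'rV[R]_(mdim M)) (phi : euclid -> euclid) :
  open W -> smooth_on W u ->
  (forall t, W t -> ccod (chart_at a) (u t)) -> is_reparam phi ->
  (forall t, W (phi t)) ->
  smooth (cinv (chart_at a) \o u \o phi) /\
    forall v, mdiff (cinv (chart_at a) \o u \o phi) origin v =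
      chart_tangent a (u 0) ('d u (0 : 'rV[R]_k) v).
Proof.
move=> Wo us ua ph pW.
have [ps p0 pd] := ph; have pk := smooth_on_euclid ps.
pose up : 'rV[R]_k -> 'rV[R]_(mdim M) := u \o phi.
have ups : smooth_on setT up.
  by move=> l; apply: (@Ck_on_comp _ _ _ _ _ _ W) => //; exact: openT.
have [cs cv] := smooth_chart_map ups (fun t => ua _ (pW t)).
have up0 : up 0 = u 0 by rewrite /up /= -[0]/origin p0.
split=> [|v]; first exact: cs.
have du : is_diff (phi origin) u ('d u (0 : 'rV[R]_k)).
  rewrite p0; split => //; apply (us 1).
  by have := pW origin; rewrite p0.
have dp : is_diff (0 : 'rV[R]_k) phi ('d phi (0 : 'rV[R]_k)).
  by split => //; apply (pk 1).
have [_ E] := is_diff_comp dp du.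
have E1 : 'd up (0 : 'rV[R]_k) v =
   'd u (0 : 'rV[R]_k) ('d phi (0 : 'rV[R]_k) v) := congr1 (@^~ _) E.
have E2 : 'd phi (0 : 'rV[R]_k) v = v := pd v.
have E3 : 'd up (0 : 'rV[R]_k) v = 'd u (0 : 'rV[R]_k) v :=
  etrans E1 (congr1 (fun w => 'd u (0 : 'rV[R]_k) w) E2).
have cv' := cv v; rewrite up0 E3 in cv'.
exact: cv'.
Qed.

Lemma reparam_into (W : set 'rV[R]_k) : open W -> W 0 ->
  exists2 phi, is_reparam phi & forall t, W (phi t).
Proof.
move=> Wo W0.
have nW : \forall t \near (0 : 'rV[R]_k), W t by exact: open_nbhs_nbhs (conj Wo W0).
have [e e0 He] := near_ball_closed nW.
have [phi [ph pe]] := reparam_exists e0.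
by exists phi => // t; apply: He; rewrite subr0 ltW.
Qed.

End euclidean_space.
Arguments origin {R k}.

(** * Curves *)

Section curve_lift.
Variable R : realType.
Implicit Types M N B : manifold R.

Lemma is_diff_mulmxr m n p (f : 'rV[R]_m -> 'rV[R]_n) (A : 'M[R]_(n, p)) x df :
  is_diff x f df -> is_diff x (fun y => f y *m A) (fun v => df v *m A).
Proof.
move=> dfx; have Ac : continuous (mulmxr A : 'rV_n -> 'rV_p).
  exact: rV_linear_continuous.
have dA : is_diff (f x) (mulmxr A : 'rV_n -> 'rV_p) (mulmxr A).
  by split; [exact: linear_differentiable|exact: diff_lin].
exact: is_diff_comp dfx dA.
Qed.

Lemma smooth_on_mulmxr m n p U (f : 'rV[R]_m -> 'rV[R]_n) (A : 'M[R]_(n, p)) :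
  open U -> smooth_on U f -> smooth_on U (fun y => f y *m A).
Proof.
move=> Uo fs k; apply: (@Ck_on_linear_comp _ _ _ _ _ _ (mulmxr A)) => //.
exact: rV_linear_continuous.
Qed.

Lemma const1_mulmx n (v : 'rV[R]_n) : (const_mx 1 : 'rV[R]_1) *m v = v.
Proof.
rewrite (_ : const_mx 1 = 1%:M) ?mul1mx//.
by apply/matrixP => i j; rewrite !ord1 !mxE.
Qed.

Lemma smooth_on_affine m n U (x0 : 'rV[R]_n) (A : 'M[R]_(m, n)) : open U ->
  smooth_on U (fun t => x0 + t *m A).
Proof.
move=> Uo k; apply: Ck_onD => //; first exact: Ck_on_cst.
exact: (Ck_on_linear _ _ (mulmxr A)).
Qed.

Definition line : manifold R := euclid R 1.

Definition velocity M (c : line -> M) : 'rV[R]_(mdim M) :=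
  mdiff c origin (const_mx 1).

Lemma velocity_comp M N (f : M -> N) (c : line -> M) : smooth f -> smooth c ->
  velocity (f \o c) = mdiff f (c origin) (velocity c).
Proof. by move=> fs cs; exact: mdiff_comp. Qed.

Lemma velocity_reparam M (c : line -> M) (phi : line -> line) :
  smooth c -> is_reparam phi -> velocity (c \o phi) = velocity c.
Proof. by move=> cs [ps p0 pv]; rewrite (velocity_comp cs ps) p0 [velocity phi]pv. Qed.

(** A straight line in the chart at [x] may leave the chart, so it is reparametrised to stay in the
    open set of times at which it lies inside. *)
Lemma curve_through M (x : M) v :
  exists c : line -> M, [/\ smooth c, c origin = x & velocity c = v].
Proof.
have xd := chart_at_dom x.
pose x0 := cfun (chart_at x) x.
pose u (t : 'rV[R]_1) := x0 + t *m v.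
have u0 : u 0 = x0 by rewrite /u mul0mx addr0.
have us U : open U -> smooth_on U u by exact: smooth_on_affine.
pose W := [set: 'rV[R]_1] `&` u @^-1` ccod (chart_at x).
have Wo : open W.
  apply: open_setI_preimage; [exact: openT| |exact: ccod_open].
  by move=> t _; apply: (us _ (@openT _) 0).
have W0 : W 0 by split=> //=; rewrite u0; exact: cfunS.
have [phi ph pW] := reparam_into Wo W0.
have ux t : W t -> ccod (chart_at x) (u t) by case.
have [cs cv] := smooth_germ_map Wo (us _ Wo) ux ph pW.
have [_ p0 _] := ph.
exists (cinv (chart_at x) \o u \o phi); split=> //.
  by rewrite /= p0 [u origin]u0 cfunK.
rewrite /velocity cv u0 chart_tangent_cfun.
have [_ E] := is_diffD (is_diff_cst x0 (0 : 'rV[R]_1))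
   (is_diff_mulmxr v (is_diff_id (0 : 'rV[R]_1))).
have E1 : 'd u (0 : 'rV[R]_1) (const_mx 1) = 0 + const_mx 1 *m v :=
  congr1 (@^~ _) E.
by rewrite E1 add0r const1_mulmx.
Qed.

Lemma curve_lift M B (f : M -> B) (x : M) (c : line -> B) v :
  smooth f -> (forall w, exists v, mdiff f x v = w) ->
  smooth c -> c origin = f x -> velocity c = mdiff f x v ->
  exists phi (g : line -> M), [/\ is_reparam phi, smooth g,
    g origin = x, velocity g = v & f \o g = c \o phi].
Proof.
move=> fs fsurj cs c0 cv.
set b := f x; pose h := loc f x b; pose x0 := cfun (chart_at x) x.
have xU : locdom f x b x0 by exact: cfun_locdom.
have [A [V [G [Vo V0 Gs _ [G0 dG hA HG]]]]] :=
  submersion_normal_form (@locdom_open _ _ _ f x b fs.1) xU (@smooth_loc _ _ _ f x b fs) fsurj.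
have hx0 : h x0 = cfun (chart_at b) b by exact: loc_cfun.
(* The part of [v] tangent to the fibre: ['d h x0 v *m A] is one lift of ['d h x0 v], and the
   difference lies in the kernel of ['d h x0]. *)
pose w := v - 'd h x0 v *m A.
pose bt : 'rV[R]_1 -> _ := loc c origin b.
pose W := locdom c origin b.
have Wo : open W by exact: locdom_open cs.1.
have W0 : W 0 by split=> //=; rewrite c0; exact: chart_at_dom.
have bs : smooth_on W bt by exact: smooth_loc.
have bt0 : bt 0 = h x0 by rewrite /bt /loc /= c0 hx0.
(* The first term makes [h (G (y t)) = bt t]. The second does not affect [h] and corrects the
   velocity from ['d h x0 v *m A] to [v]. *)
pose y t := (bt t - h x0) *m A + t *m w.
have y0 : y 0 = 0 by rewrite /y bt0 subrr !mul0mx addr0.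
have ys : smooth_on W y.
  move=> k; apply: Ck_onD => //.
    apply: (smooth_on_mulmxr A Wo) => {}k; apply: Ck_onD => //; exact: Ck_on_cst.
  exact: (Ck_on_linear _ _ (mulmxr w)).
have dy : 'd y (0 : 'rV[R]_1) (const_mx 1) = v.
  have db : is_diff (0 : 'rV[R]_1) bt ('d bt (0 : 'rV[R]_1)).
    by split => //; apply (bs 1).
  have db' := is_diffB db (is_diff_cst (h x0) (0 : 'rV[R]_1)).
  have [_ E] := is_diffD (is_diff_mulmxr A db')
     (is_diff_mulmxr w (is_diff_id (0 : 'rV[R]_1))).
  have E1 : 'd y (0 : 'rV[R]_1) (const_mx 1) =
    ('d bt (0 : 'rV[R]_1) (const_mx 1) - 0) *m A + const_mx 1 *m w :=
    congr1 (@^~ _) E.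
  have E2 : 'd bt (0 : 'rV[R]_1) (const_mx 1) = 'd h x0 v.
    by move: cv; rewrite /velocity /mdiff c0; exact: id.
  by rewrite E1 E2 subr0 const1_mulmx /w addrC subrK.
have hw : 'd h x0 w = 0.
  by rewrite /w linearB hA subrr.
pose W' := W `&` y @^-1` V.
have Wo' : open W'.
  apply: open_setI_preimage => // t Wt; exact: (ys 0).
have W0' : W' 0 by split=> //=; rewrite y0.
pose u := G \o y.
have us : smooth_on W' u.
  move=> k; apply: (@Ck_on_comp _ _ _ _ _ _ V) => //; first by move=> t [].
  by apply: Ck_on_sub (ys k) => t [].
have uU t : W' t -> locdom f x b (u t) by move=> [_ /HG[]].
have u0 : u 0 = x0 by rewrite /u /= y0 G0.
have du : 'd u (0 : 'rV[R]_1) (const_mx 1) = v.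
  have dy1 : is_diff (0 : 'rV[R]_1) y ('d y (0 : 'rV[R]_1)).
    by split => //; apply (ys 1).
  have dG1 : is_diff (y 0) G ('d G (0 : 'rV[R]_(mdim M))).
    by rewrite y0; split => //; apply (Gs 1).
  have [_ E] := is_diff_comp dy1 dG1.
  have E1 : 'd u (0 : 'rV[R]_1) (const_mx 1) = 'd G 0 ('d y (0 : 'rV[R]_1) (const_mx 1)) :=
    congr1 (@^~ _) E.
  by rewrite E1 dG dy.
have [phi ph pW] := reparam_into Wo' W0'.
have [gs gv] := smooth_germ_map Wo' us (fun t Wt => (uU t Wt).1) ph pW.
exists phi, (cinv (chart_at x) \o u \o phi); split.
- exact: ph.
- exact: gs.
- case: ph => _ p0 _; rewrite /= p0 [u origin]u0 cfunK//; exact: chart_at_dom.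
- by rewrite /velocity gv u0 chart_tangent_cfun du.
apply/funext => t /=; have [[_ /= cb] yV] := pW t; have [_ /= fb] := uU _ (pW t).
rewrite -(cfunK fb) -(cfunK cb); congr (cinv _ _).
have [_] := HG _ yV; rewrite -/h => E.
have -> : cfun (chart_at b) (f (cinv (chart_at x) (u (phi t)))) = h (G (y (phi t))) by [].
rewrite E /y linearD hA addrA.
have -> : 'd h x0 ((phi t : 'rV[R]_1) *m w) = 0.
  by rewrite [phi t]mx11_scalar mul_scalar_mx linearZ hw; exact: scaler0.
by rewrite addr0 addrC subrK.
Qed.

End curve_lift.

Arguments line R : clear implicits.

(** * Differential forms *)

Section forms.
Variables (R : realType) (V : vectType R) (p : nat).
Implicit Types M N B : manifold R.

(** A form in one of its arguments, packed so that [linear_sum] and [linearZ] apply to that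
    argument. *)
Definition form_slot M (w : Defs.form p M V) x v i (u : 'rV[R]_(mdim M)) : V :=
  form_val w x [eta v with i |-> u].

Fact form_slot_linear M (w : Defs.form p M V) x v i : linear (form_slot w x v i).
Proof. by have [wl _ _] := formP w; move=> a u u'; exact: wl. Qed.

HB.instance Definition _ M (w : Defs.form p M V) x v i :=
  GRing.isLinear.Build _ _ _ _ _ (form_slot_linear w x v i).

(** [is_form] tests constant fields in a chart only; pulling back and descending produce fields
    [z i] that vary with the point. Multilinearity reduces these to constant fields with smooth
    coefficients. *)
Lemma form_smooth_along N (w : Defs.form p N V) (c : N) m (U : set 'rV[R]_m)
    (h : 'rV[R]_m -> 'rV[R]_(mdim N)) (z : 'I_p -> 'rV[R]_m -> 'rV[R]_(mdim N)) :
  open U -> (forall y, U y -> ccod (chart_at c) (h y)) -> smooth_on U h ->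
  (forall i, smooth_on U (z i)) ->
  smooth_on U (fun y => v2r (form_val w (cinv (chart_at c) (h y))
    (fun i => chart_tangent c (h y) (z i y)))).
Proof.
move=> Uo hU hs zs.
(* Induction on a bound [k] for the slots that may carry a nonconstant field; the step expands the
   field in slot [k] in the standard basis. *)
suff H k (z' : 'I_p -> 'rV[R]_m -> 'rV[R]_(mdim N)) : (forall i, smooth_on U (z' i)) ->
    (forall i : 'I_p, (k <= i)%N -> exists v, z' i = fun=> v) ->
    smooth_on U (fun y => v2r (form_val w (cinv (chart_at c) (h y))
      (fun i => chart_tangent c (h y) (z' i y)))).
  by apply: (H p) => // i; rewrite leqNgt ltn_ord.
elim: k z' => [|k IH] z' z's z'c l.
  have [v hv] := choice (fun i => z'c i (leq0n i)).
  have [_ _ ws] := formP w.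
  have := @Ck_on_comp _ _ _ _ l U _ h _ Uo hU (hs l) (ws c v l).
  apply: Ck_on_ext => // y _ /=; congr (v2r (form_val w _ _)).
  by apply/funext => i; rewrite hv.
have [kp|pk] := ltnP k p; last first.
  by apply: IH => // i /(leq_trans pk); rewrite leqNgt ltn_ord.
pose i0 := Ordinal kp.
pose z1 j i : 'rV[R]_m -> 'rV[R]_(mdim N) := if i == i0 then fun=> delta_mx 0 j else z' i.
have E y : v2r (form_val w (cinv (chart_at c) (h y)) (fun i => chart_tangent c (h y) (z' i y))) =
  \sum_j z' i0 y 0 j *: v2r (form_val w (cinv (chart_at c) (h y))
     (fun i => chart_tangent c (h y) (z1 j i y))).
  pose u i := chart_tangent c (h y) (z' i y).
  rewrite -[LHS]/(v2r (form_val w _ u)) (_ : u = [eta u with i0 |-> u i0]); last first.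
    by apply/funext => i /=; case: eqP => // ->.
  rewrite -[form_val w _ _]/(form_slot w (cinv (chart_at c) (h y)) u i0 (u i0)).
  rewrite [u i0]/u (rV_linear_sum (chart_tangent c (h y))) !linear_sum.
  apply: eq_bigr => j _; rewrite !linearZ; congr (_ *: v2r (form_val w _ _)).
  by apply/funext => i /=; rewrite /z1; case: eqP.
have := @Ck_on_ext _ _ _ l U _ _ Uo (fun y _ => esym (E y)).
apply; apply: Ck_on_sum => // j; apply: Ck_onZ => //.
  by apply: Ck_on_coord => //; exact: z's.
apply: IH => i; rewrite /z1; case: eqP => [_|ne].
- by move=> ?; exact: Ck_on_cst.
- exact: z's.
- by exists (delta_mx 0 j).
- move=> ki; apply: z'c; rewrite ltn_neqAle ki andbT.
  by apply/eqP => ki'; apply: ne; exact/val_inj.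
Qed.

End forms.

(** The chart at [z] is any chart containing [f x], because smoothness of a form is tested on every
    chart of the atlas. *)
Lemma local_section (R : realType) (M B : manifold R) (f : M -> B) (x : M) (z : B) :
  smooth f -> (forall w, exists v, mdiff f x v = w) -> cdom (chart_at z) (f x) ->
  exists (V : set 'rV[R]_(mdim B)) (s : 'rV[R]_(mdim B) -> 'rV[R]_(mdim M)),
  [/\ open V, V (cfun (chart_at z) (f x)), smooth_on V s &
      forall y, V y -> locdom f x z (s y) /\ loc f x z (s y) = y].
Proof.
move=> fs fsurj fxz; pose x0 := cfun (chart_at x) x; pose h := loc f x z.
have xd := chart_at_dom x.
have xU : locdom f x z x0 by split; [exact: cfunS|rewrite /= cfunK].
have hx0 : h x0 = cfun (chart_at z) (f x) by rewrite /h /loc /= cfunK.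
have zU : locdom id z (f x) (h x0).
  by rewrite hx0; split; [exact: cfunS|rewrite /= cfunK//; exact: chart_at_dom].
have xU' : locdom f x (f x) x0 by exact: cfun_locdom.
have bz : locdom id (f x) z (loc f x (f x) x0).
  rewrite loc_cfun; have fd := chart_at_dom (f x).
  by split; [exact: cfunS|rewrite /= cfunK].
(* Surjectivity is given in the preferred chart at [f x]; the invertible change of charts carries it
   to the chart at [z]. *)
have hsurj w : exists v, 'd h x0 v = w.
  have [v vw] := fsurj ('d (loc id z (f x)) (h x0) w).
  have y1 : loc id z (f x) (h x0) = loc f x (f x) x0.
    by rewrite loc_cfun hx0 /loc /= cfunK.
  exists v; have E1 := loc_comp_diff v fs (@smooth_id _ B) xU' bz.
  have E2 := loc_idK w zU; rewrite y1 in E2.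
  have vw' : 'd (loc f x (f x)) x0 v = 'd (loc id z (f x)) (h x0) w := vw.
  have E3 := congr1 (fun u => 'd (loc id (f x) z) (loc f x (f x) x0) u) vw'.
  exact: etrans E1 (etrans E3 E2).
have [A [W [G [Wo W0 Gs _ [_ _ hA HG]]]]] :=
  submersion_normal_form (@locdom_open _ _ _ f x z fs.1) xU
    (@smooth_loc _ _ _ f x z fs) hsurj.
(* In the normal form [h \o G] is [h x0 + 'd h x0], and multiplication by [A] is a right inverse of
   ['d h x0]. *)
pose t y := (y - h x0) *m A.
have ts U : open U -> smooth_on U t.
  move=> Uo; apply: (smooth_on_mulmxr A Uo) => k; apply: Ck_onD => //.
    exact: (Ck_on_linear _ _ idfun).
  exact: Ck_on_cst.
pose V := setT `&` t @^-1` W.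
have Vo : open V.
  apply: open_setI_preimage; [exact: openT| |exact: Wo].
  by move=> y _; exact: (ts _ (@openT _) 0 y I).
exists V, (G \o t); split; first exact: Vo.
- by split => //=; rewrite -hx0 /t subrr mul0mx.
- move=> k; apply: (@Ck_on_comp _ _ _ _ _ _ W) => //; first by move=> y [].
  exact: ts.
- move=> y [_ /HG[Uy hy]]; split; first exact: Uy.
  by move: hy; rewrite hA addrC subrK.
Qed.

Section form_constructions.
Variables (R : realType) (p : nat).
Implicit Types (M N B : manifold R) (V : vectType R).

Lemma is_form_local M V (w : pre_form p M V) :
  (forall x v i a (u u' : 'rV[R]_(mdim M)),
        w x [eta v with i |-> a *: u + u'] =
        a *: w x [eta v with i |-> u] + w x [eta v with i |-> u']) ->
  (forall x v i j, i != j -> v i = v j -> w x v = 0) ->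
  (forall (z : M) (v : 'I_p -> 'rV[R]_(mdim M)) y, ccod (chart_at z) y ->
    exists U, [/\ open U, U y & smooth_on U (fun y =>
       v2r (w (cinv (chart_at z) y) (fun i => chart_tangent z y (v i))))]) ->
  is_form w.
Proof.
move=> wl wa ws; split => // z v k; apply: Ck_on_local => y /(ws z v)[U [Uo Uy Us]].
by exists U => //; exact: Us.
Qed.

(** In charts the pullback evaluated on constant fields [v i] is [w] along [loc f z b] evaluated on
    the smooth fields ['d (loc f z b) y (v i)]. *)
Lemma pullback_is_form M N V (f : M -> N) (w : Defs.form p N V) : smooth f ->
  is_form (pullback f w).
Proof.
move=> fs; have [wl wa _] := formP w; apply: is_form_local.
- move=> x v i a u u'; rewrite /pullback.
  have E b : (fun j => mdiff f x ([eta v with i |-> b] j)) =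
      [eta (fun j => mdiff f x (v j)) with i |-> mdiff f x b].
    by apply/funext => j /=; case: eqP.
  by rewrite !E linearP wl.
- by move=> x v i j ij vij; apply: (wa _ _ i j) => //; rewrite vij.
move=> z v y zy; pose b := f (cinv (chart_at z) y).
have Uo := @locdom_open _ _ _ f z b fs.1.
exists (locdom f z b); split; first exact: Uo.
  by split=> //; exact: chart_at_dom.
have hs := @smooth_loc _ _ _ f z b fs.
have H := @form_smooth_along R V p N w b _ (locdom f z b) (loc f z b)
  (fun i y => 'd (loc f z b) y (v i)) Uo.
move=> k; apply: (@Ck_on_ext _ _ _ _ _ _ _ Uo); last first.
  apply: H k => //; first by move=> t [_ tb]; exact: cfunS.
  by move=> i k; apply (hs k.+1).
move=> t tU; congr v2r; rewrite /pullback /loc /= cfunK; last exact: tU.2.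
congr (form_val w _ _); apply/funext => i.
by rewrite -(mdiff_chart_tangent _ fs tU).
Qed.

Lemma form_add_is_form M V (w w' : Defs.form p M V) : is_form (form_add w w').
Proof.
have [wl wa ws] := formP w; have [wl' wa' ws'] := formP w'.
split; rewrite /form_add.
- by move=> x v i a u u'; rewrite wl wl' scalerDr addrACA.
- by move=> x v i j ij vij; rewrite (wa _ _ i j)// (wa' _ _ i j)// addr0.
move=> z v k; have := Ck_onD (@ccod_open _ _ _ (chart_at z)) (ws z v k) (ws' z v k).
apply: Ck_on_ext; first exact: ccod_open.
by move=> y _; rewrite -linearD.
Qed.

Lemma form_map_is_form M V V' (l : {linear V -> V'}) (w : Defs.form p M V) :
  is_form (form_map l w).
Proof.
have [wl wa ws] := formP w; split; rewrite /form_map.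
- by move=> x v i a u u'; rewrite wl linearP.
- by move=> x v i j ij vij; rewrite (wa _ _ i j)// linear0.
move=> z v k.
pose L : {linear 'rV[R]_(dim V) -> 'rV[R]_(dim V')} := v2r \o l \o r2v.
have := Ck_on_linear_comp (L := L) (@ccod_open _ _ _ (chart_at z))
  (@rV_linear_continuous _ _ _ L) (ws z v k).
apply: Ck_on_ext; first exact: ccod_open.
by move=> y _; rewrite /L /= v2rK.
Qed.

Lemma form_sub_is_form M V (w w' : Defs.form p M V) : is_form (form_sub w w').
Proof.
have := form_add_is_form w (Form (form_map_is_form (-%R : {linear V -> V}) w')).
by [].
Qed.

End form_constructions.

(** * Descent of forms along surjective submersions *)

Section descent.
Variables (R : realType) (p : nat) (V : vectType R).
Implicit Types M B : manifold R.

Lemma lift_tangents M B (f : M -> B) x (u : 'I_p -> 'rV[R]_(mdim B)) :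
  surjective_submersion f ->
  exists v : 'I_p -> 'rV[R]_(mdim M), (fun i => mdiff f x (v i)) = u.
Proof.
case=> _ _ fsub; have [v hv] := choice (fun i => fsub x (u i)).
by exists v; apply/funext.
Qed.

Lemma pullback_inj M B (f : M -> B) (w w' : pre_form p B V) :
  surjective_submersion f -> pullback f w = pullback f w' -> w = w'.
Proof.
move=> fsub E; apply/funext => b; apply/funext => u.
have [_ /(_ b)[x <-] _] := fsub; have [v <-] := lift_tangents x u fsub.
have E1 : pullback f w x v = pullback f w' x v by rewrite E.
exact: E1.
Qed.

(** The form is defined by arbitrarily chosen preimages and lifts. By hypothesis any other choice
    gives the same value, so each axiom is checked with a convenient one: linear combinations of
    lifts for multilinearity, a smooth local section for smoothness. *)
Lemma form_descent M B (f : M -> B) (w : Defs.form p M V) :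
  surjective_submersion f ->
  (forall x x' (v v' : 'I_p -> 'rV[R]_(mdim M)), f x = f x' ->
    (forall i, mdiff f x (v i) = mdiff f x' (v' i)) ->
    form_val w x v = form_val w x' v') ->
  exists w' : Defs.form p B V, pullback f w' = form_val w.
Proof.
move=> fsub wf; have [fs fsurj fd] := fsub; have [wl wa _] := formP w.
have [s fK] := choice fsurj.
(* One lift for each vector, whatever its slot: equal arguments get equal lifts, so the alternating
   property is inherited. *)
have [l lK'] := choice (fun bu : B * 'rV[R]_(mdim B) => fd (s bu.1) bu.2).
have lK b u : mdiff f (s b) (l (b, u)) = u := lK' (b, u).
pose w' : pre_form p B V := fun b u => form_val w (s b) (fun i => l (b, u i)).
have w'f x v b u : f x = b -> (forall i, mdiff f x (v i) = u i) ->
    w' b u = form_val w x v.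
  by move=> xb vu; apply: wf => [|i]; rewrite ?fK// lK vu.
have w'F : is_form w'.
  apply: is_form_local.
  - move=> b u i a t t'; pose v j := l (b, u j).
    have up t0 y : mdiff f (s b) y = t0 ->
        w' b [eta u with i |-> t0] = form_val w (s b) [eta v with i |-> y].
      by move=> yt; apply: w'f => // j /=; case: eqP => // _; exact: lK.
    rewrite (up t (l (b, t)) (lK _ _)) (up t' (l (b, t')) (lK _ _)).
    rewrite (up _ (a *: l (b, t) + l (b, t'))); first exact: wl.
    by rewrite (mdiff_linear f (s b)) !lK.
  - by move=> b u i j ij uij; apply: (wa _ _ i j) => //; rewrite uij.
  move=> z u y zy; pose b := cinv (chart_at z) y; pose x := s b.
  have fxz : cdom (chart_at z) (f x) by rewrite fK; exact: cinvS.
  have [W [t [Wo Wy ts tW]]] := local_section fs (fd x) fxz.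
  rewrite fK cinvK// in Wy.
  exists W; split; [exact: Wo|exact: Wy|move=> k].
  (* The section [t] lifts the constant fields to ['d t y (u i)]; they project back since
     [loc f x z \o t] is the identity near each point of [W]. *)
  have H := @form_smooth_along R V p M w x _ W t (fun i y => 'd t y (u i)) Wo.
  apply: (@Ck_on_ext _ _ _ _ _ _ _ Wo); last first.
    apply: H k => //; first by move=> q /tW[[]].
    by move=> i k; apply (ts k.+1).
  move=> q qW; have [tq fq] := tW _ qW.
  have fxq : f (cinv (chart_at x) (t q)) = cinv (chart_at z) q.
    by rewrite -[in RHS]fq /loc /= cfunK//; exact: tq.2.
  congr v2r; apply/esym/w'f => // i.
  rewrite (mdiff_chart_tangent _ fs tq) fq; congr (chart_tangent z q _).
  have dt : is_diff q t ('d t q) by split => //; apply (ts 1).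
  have dh := loc_diff fs tq.
  have nid : \forall y \near q, y = (loc f x z \o t) y.
    by apply: filterS (open_nbhs_nbhs (conj Wo qW)) => y' /tW[_ /= ->].
  have [_ E1] := near_eq_is_diff nid (is_diff_id _).
  have [_ E2] := is_diff_comp dt dh.
  have E3 : 'd (loc f x z \o t) q (u i) = u i := congr1 (@^~ (u i)) E1.
  have E4 : 'd (loc f x z \o t) q (u i) = 'd (loc f x z) (t q) ('d t q (u i)) :=
    congr1 (@^~ (u i)) E2.
  exact: etrans (esym E4) E3.
exists (Form w'F); apply/funext => x; apply/funext => v.
exact: w'f.
Qed.

End descent.

(** * Tangent vectors of fibre products *)

Lemma continuous_near (T S : topologicalType) (f : T -> S) x (A : set S) :
  {for x, continuous f} -> (\forall y \near f x, A y) ->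
  \forall y \near x, A (f y).
Proof. by move=> fx; exact: fx. Qed.

Lemma near_and (T : topologicalType) (x : T) (A B : T -> Prop) :
  (\forall y \near x, A y) -> (\forall y \near x, B y) ->
  \forall y \near x, A y /\ B y.
Proof. by move=> xA xB; exact: filterI. Qed.

Section fibre_products.
Variable R : realType.
Implicit Types M N B T : manifold R.

Lemma fp_lift M N (B : Type) (f : M -> B) (g : N -> B) (P : fibre_product f g) T
    (a : T -> M) (b : T -> N) : smooth a -> smooth b ->
  (forall t, f (a t) = g (b t)) ->
  exists e : T -> P, [/\ smooth e, fp1 P \o e = a & fp2 P \o e = b].
Proof.
move=> sa sb ab; pose e t := fpair P (ab t).
have e1 : fp1 P \o e = a by apply/funext => t; exact: fpair1.
have e2 : fp2 P \o e = b by apply/funext => t; exact: fpair2.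
by exists e; split => //; apply: fp_smooth; rewrite ?e1 ?e2.
Qed.

(** Take a curve in [M] with velocity [v], push it to [B] and lift it through [g] to a curve in [N]
    with velocity [w]. The two curves, equally reparametrised, pair to a curve in [P] whose velocity
    is the required vector. *)
Lemma fp_tangent_surj M N B (f : M -> B) (g : N -> B) (P : fibre_product f g)
    (z : P) v w : smooth f -> smooth g ->
  (forall u, exists w, mdiff g (fp2 P z) w = u) ->
  mdiff f (fp1 P z) v = mdiff g (fp2 P z) w ->
  exists u, mdiff (fp1 P) z u = v /\ mdiff (fp2 P) z u = w.
Proof.
move=> fs gs gsub vw.
have [c [cs c0 cv]]  := @curve_through _ _ (fp1 P z) v.
have fcs : smooth (f \o c) by exact: smooth_comp.
have fc0 : (f \o c) origin = g (fp2 P z) by rewrite /= c0; exact: fp_comm.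
have fcv : velocity (f \o c) = mdiff g (fp2 P z) w.
  by rewrite velocity_comp// c0 cv.
have [phi [d [ph ds d0 dv fgd]]] := curve_lift gs gsub fcs fc0 fcv.
have cps : smooth (c \o phi) by apply: smooth_comp => //; case: ph.
have [e [es e1 e2]] := @fp_lift _ _ _ f g P _ (c \o phi) d cps ds
  (fun t => esym (congr1 (@^~ t) fgd)).
have e0 : e origin = z.
  apply: (@fp_inj _ _ _ _ _ _ P).
    rewrite -[LHS]/((fp1 P \o e) origin) e1 /=.
    by case: ph => _ -> _.
  by rewrite -[LHS]/((fp2 P \o e) origin) e2 d0.
exists (velocity e); split.
  have := velocity_comp (@fp1_smooth _ _ _ _ _ _ P) es.
  by rewrite e1 e0 velocity_reparam// cv.
have := velocity_comp (@fp2_smooth _ _ _ _ _ _ P) es.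
by rewrite e2 e0 dv.
Qed.

(* Near [z] the map [(fp1, fp2)] has a smooth left inverse defined on an open
   subset of the product of the charts; it is built with the normal form of
   [g], and its smoothness is the universal property of the fibre product. *)
Lemma fp_tangent_inj M N B (f : M -> B) (g : N -> B) (P : fibre_product f g)
    (z : P) u : smooth f -> smooth g ->
  (forall u, exists w, mdiff g (fp2 P z) w = u) ->
  mdiff (fp1 P) z u = 0 -> mdiff (fp2 P) z u = 0 -> u = 0.
Proof.
move=> fs gs gsub u1 u2.
set a := fp1 P z in u1 *; set b := fp2 P z in gsub u2 *.
pose m := mdim M; pose n := mdim N; pose c := g b.
have fa : f a = c by exact: fp_comm.
pose x0 := cfun (chart_at a) a; pose y0 := cfun (chart_at b) b.
pose h := loc g b c; pose D := jac h y0.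
have bU : locdom g b c y0 by exact: cfun_locdom.
have [A [V [G [Vo V0 Gs nG [G0 dG hA HG]]]]] :=
  submersion_normal_form (@locdom_open _ _ _ g b c gs.1) bU
    (@smooth_loc _ _ _ g b c gs) gsub.
rewrite -/h -/y0 in nG hA HG.
pose Q1 : 'M[R]_(m + n, m) := col_mx 1%:M 0.
pose Q2 : 'M[R]_(m + n, n) := col_mx 0 1%:M.
pose P1 : 'M[R]_(m, m + n) := row_mx 1%:M 0.
pose P2 : 'M[R]_(n, m + n) := row_mx 0 1%:M.
pose xi (t : 'rV[R]_(m + n)) := x0 + t *m Q1.
pose W0 := locdom f a c.
have W0o : open W0 by exact: locdom_open fs.1.
pose W1 := setT `&` xi @^-1` W0.
have xis U : open U -> smooth_on U xi by exact: smooth_on_affine.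
have W1o : open W1.
  apply: open_setI_preimage; [exact: openT| |exact: W0o].
  by move=> t _; exact: (xis _ (@openT _) 0 t I).
(* For [t] standing for [(x - x0, y - y0)], this is the normal-form coordinate of [y] with [h y]
   replaced by the value of [f] at [x]. Hence [G (tau t)] always lies over that value, and it is [y]
   itself when [f] and [g] agree at [(x, y)] near the base point. *)
pose tau t := (loc f a c (xi t) - h y0) *m A + (t *m Q2) *m (1%:M - D *m A).
have taus : smooth_on W1 tau.
  move=> l; apply: Ck_onD => //.
    apply: (smooth_on_mulmxr A W1o) => {}l; apply: Ck_onD => //; last exact: Ck_on_cst.
    apply: (@Ck_on_comp _ _ _ _ _ _ W0) => //; first by move=> t [].
      exact: xis.
    exact: smooth_loc.
  apply: (smooth_on_mulmxr _ W1o) => {}l; exact: (Ck_on_linear _ _ (mulmxr Q2)).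
pose W := W1 `&` tau @^-1` V.
have Wo : open W by apply: open_setI_preimage => // t; exact: (taus 0).
have xi0 : xi 0 = x0 by rewrite /xi mul0mx addr0.
have h0 : h y0 = cfun (chart_at c) c by exact: loc_cfun.
have f0 : loc f a c x0 = h y0 by rewrite h0 -fa; exact: loc_cfun.
have tau0 : tau 0 = 0 by rewrite /tau xi0 f0 subrr !mul0mx addr0.
have W00 : W 0.
  by split; [split => //; rewrite /= xi0 /W0 -fa; exact: cfun_locdom|rewrite /= tau0].
have [phi ph pW] := reparam_into Wo W00; have [ps p0 pd] := ph.
have [Xs _] := smooth_germ_map (a := a) Wo (xis _ Wo) (fun t Wt => Wt.1.2.1) ph pW.
have Gts : smooth_on W (G \o tau).
  move=> l; apply: (@Ck_on_comp _ _ _ _ _ _ V) => //; first by move=> t [].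
  by apply: Ck_on_sub (taus l) => t [].
have GtU t : W t -> locdom g b c (G (tau t)) by move=> [_ /HG[]].
have [Ys _] := smooth_germ_map (a := b) Wo Gts (fun t Wt => (GtU t Wt).1) ph pW.
have fgE t : f ((cinv (chart_at a) \o xi \o phi) t) =
             g ((cinv (chart_at b) \o (G \o tau) \o phi) t).
  have Wt := pW t; have [[_ [_ /= fc]] tV] := Wt; have [_ /= gc] := GtU _ Wt.
  rewrite /= -(cfunK fc) -(cfunK gc); congr (cinv _ _).
  have [_ hG] := HG _ tV.
  have E : 'd h y0 (phi t *m Q2 *m (1%:M - D *m A)) = 0.
    rewrite mulmxBr mulmx1 (mulmxA _ D A) [X in X *m A](mul_jac h) linearB hA.
    exact: subrr.
  have hGt : h (G (tau (phi t))) = loc f a c (xi (phi t)).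
    by rewrite hG /tau linearD hA E addr0 addrC subrK.
  exact: esym hGt.
have [e [es e1 e2]] := @fp_lift _ _ _ f g P _ _ _ Xs Ys fgE.
have dphi v : 'd (phi : 'rV[R]_(m + n) -> 'rV[R]_(m + n)) (0 : 'rV[R]_(m + n)) v = v.
  exact: pd.
(* [e] is defined through [phi], which is locally invertible because its differential at the origin
   is the identity; [psi] undoes it. *)
have [V' [psi [Vo' V0' psis npsi Hpsi]]] :=
  local_inverse openT (x0 := 0 : 'rV[R]_(m + n)) I (smooth_on_euclid ps) dphi.
have psi0 : psi 0 = 0.
  by have := nbhs_singleton npsi; rewrite -[X in phi X]/origin p0.
rewrite -[X in phi X]/origin p0 in V0'.
pose z0 := cfun (chart_at z) z.
pose S0 := locdom (fp1 P) z a `&` locdom (fp2 P) z b.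
have zS : S0 z0 by split; exact: cfun_locdom.
have s1 := @fp1_smooth _ _ _ _ _ _ P; have s2 := @fp2_smooth _ _ _ _ _ _ P.
pose k1 := loc (fp1 P) z a; pose k2 := loc (fp2 P) z b.
have k1z : k1 z0 = x0 by exact: loc_cfun.
have k2z : k2 z0 = y0 by exact: loc_cfun.
pose kap s := (k1 s - x0) *m P1 + (k2 s - y0) *m P2.
have kap0 : kap z0 = 0 by rewrite /kap k1z k2z !subrr !mul0mx addr0.
have d1 : is_diff z0 k1 ('d k1 z0) by exact: loc_diff s1 zS.1.
have d2 : is_diff z0 k2 ('d k2 z0) by exact: loc_diff s2 zS.2.
have dk := is_diffD (is_diff_mulmxr P1 (is_diffB d1 (is_diff_cst x0 z0)))
  (is_diff_mulmxr P2 (is_diffB d2 (is_diff_cst y0 z0))).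
have kapu : 'd kap z0 u = 0.
  have [_ E] := dk.
  have E1 : 'd kap z0 u = ('d k1 z0 u - 0) *m P1 + ('d k2 z0 u - 0) *m P2 :=
    congr1 (@^~ u) E.
  have E2 : 'd k1 z0 u = 0 := u1.
  have E3 : 'd k2 z0 u = 0 := u2.
  by rewrite E1 E2 E3 !subr0 !mul0mx addr0.
have kapc : {for z0, continuous kap}.
  by apply: differentiable_continuous; have [] := dk.
have k2c : {for z0, continuous k2}.
  by apply: differentiable_continuous; have [] := d2.
have So : open S0 by apply: openI; apply: locdom_open; [exact: s1.1|exact: s2.1].
have nS : \forall s \near z0, S0 s by exact: open_nbhs_nbhs (conj So zS).
have nV : \forall s \near z0, V' (kap s).
  by apply: (continuous_near (A := V') kapc); rewrite kap0; exact: open_nbhs_nbhs (conj Vo' V0').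
have nk2 : \forall s \near z0,
    G ((h (k2 s) - h y0) *m A + (k2 s - y0 - 'd h y0 (k2 s - y0) *m A)) = k2 s.
  by apply: (continuous_near
    (A := fun q => G ((h q - h y0) *m A + (q - y0 - 'd h y0 (q - y0) *m A)) = q) k2c);
    rewrite k2z; exact: nG.
have eP s : S0 s -> V' (kap s) ->
    G ((h (k2 s) - h y0) *m A + (k2 s - y0 - 'd h y0 (k2 s - y0) *m A)) = k2 s ->
    e (psi (kap s)) = cinv (chart_at z) s.
  move=> [[zs a1] [_ b2]] Vs Gs2; have [_ phipsi] := Hpsi _ Vs.
  have P11 : P1 *m Q1 = 1%:M by rewrite mul_row_col mulmx1 mul0mx addr0.
  have P21 : P2 *m Q1 = 0 by rewrite mul_row_col mulmx0 mul0mx addr0.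
  have P12 : P1 *m Q2 = 0 by rewrite mul_row_col mulmx0 mul0mx addr0.
  have P22 : P2 *m Q2 = 1%:M by rewrite mul_row_col mulmx1 mul0mx add0r.
  have kQ1 : kap s *m Q1 = k1 s - x0.
    by rewrite /kap mulmxDl -!mulmxA P11 P21 mulmx1 mulmx0 addr0.
  have kQ2 : kap s *m Q2 = k2 s - y0.
    by rewrite /kap mulmxDl -!mulmxA P12 P22 mulmx1 mulmx0 add0r.
  have xik : xi (kap s) = k1 s by rewrite /xi kQ1 addrC subrK.
  apply: (@fp_inj _ _ _ _ _ _ P).
    rewrite -[LHS]/((fp1 P \o e) _) e1 /= phipsi xik /k1 /loc /=.
    exact: cfunK.
  rewrite -[LHS]/((fp2 P \o e) _) e2 /= phipsi /tau xik kQ2.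
  have -> : loc f a c (k1 s) = h (k2 s).
    by rewrite /h /k1 /k2 /loc /= (cfunK a1) (cfunK b2) fp_comm.
  rewrite mulmxBr mulmx1 mulmxA -/k2 (mul_jac h _ (k2 s - y0)) Gs2 /k2 /loc /=.
  exact: cfunK.
have eo : e origin = z.
  have := eP z0 zS; rewrite kap0 psi0 => -> //.
  - exact: cfunK (chart_at_dom z).
  - by have := nbhs_singleton nk2.
pose le := loc e origin z.
have lez : locdom e origin z (0 : 'rV[R]_(m + n)).
  by split => //=; rewrite -[X in e X]/origin eo; exact: chart_at_dom.
(* So [le \o psi] is a left inverse of [kap], the chart expression of [(fp1, fp2)]; differentiating
   at [z0] recovers [u] from ['d kap z0 u = 0]. *)
have nid : \forall s \near z0, s = (le \o (psi \o kap)) s.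
  have nSV := near_and nS (near_and nV nk2).
  apply: filterS nSV => s [Ss [Vs ks]]; rewrite /le /loc /= (eP s Ss Vs ks).
  by rewrite cinvK//; exact: Ss.1.1.
have [_ E] := near_eq_is_diff nid (is_diff_id _).
have dkap : is_diff z0 kap ('d kap z0) by split => //; have [] := dk.
have dpsi : is_diff (kap z0) psi ('d psi (0 : 'rV[R]_(m + n))).
  by rewrite kap0; split => //; apply (psis 1).
have dle : is_diff ((psi \o kap) z0) le ('d le (0 : 'rV[R]_(m + n))).
  rewrite /= kap0 psi0; exact: loc_diff es lez.
have [_ E'] := is_diff_comp (is_diff_comp dkap dpsi) dle.
have E1 : 'd (le \o (psi \o kap)) z0 u = u := congr1 (@^~ u) E.
have E2 : 'd (le \o (psi \o kap)) z0 u =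
    'd le (0 : 'rV[R]_(m + n)) ('d psi (0 : 'rV[R]_(m + n)) ('d kap z0 u)) :=
  congr1 (@^~ u) E'.
rewrite kapu in E2.
have E3 : 'd le (0 : 'rV[R]_(m + n)) ('d psi (0 : 'rV[R]_(m + n)) 0) = 0.
  by rewrite !linear0.
exact: etrans (esym E1) (etrans E2 E3).
Qed.

End fibre_products.

(** * Anafunctors *)

Lemma comp_eqE A B C (f : B -> C) (g : A -> B) (h : A -> C) :
  f \o g = h -> forall t, f (g t) = h t.
Proof. by move=> <-. Qed.

Section pullbacks.
Variable R : realType.
Implicit Types M N P : manifold R.

Lemma pullback_comp p M N P V (f : M -> N) (g : N -> P) (w : pre_form p P V) :
  smooth f -> smooth g -> pullback (g \o f) w = pullback f (pullback g w).
Proof.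
move=> fs gs; apply/funext => x; apply/funext => v; rewrite /pullback.
by congr (w _ _); apply/funext => i; exact: mdiff_comp.
Qed.

Lemma pullback_eq p M N V (f : M -> N) (w : pre_form p N V) x y v u : f x = y ->
  (forall i, mdiff f x (v i) = u i) -> pullback f w x v = w y u.
Proof. by move=> <- vu; rewrite /pullback; congr (w _ _); apply/funext. Qed.

Lemma pullback_square p M N N' P V (f : M -> N) (g : N -> P) (f' : M -> N')
    (g' : N' -> P) (fs : smooth f) (gs : smooth g) (fs' : smooth f')
    (gs' : smooth g') (w : pre_form p P V) :
  g \o f = g' \o f' -> pullback f (pullback g w) = pullback f' (pullback g' w).
Proof. by move=> E; rewrite -(pullback_comp w fs gs) E pullback_comp. Qed.

Lemma form_val_inj p M (V : vectType R) : injective (@form_val R p M V).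
Proof.
by move=> [w wP] [w' wP'] /= E; subst w'; congr Form; exact: Prop_irrelevance.
Qed.

Lemma mdiff_velocity M N (f : M -> N) (c : line R -> M) (d : line R -> N) x :
  smooth f -> smooth c -> c origin = x -> f \o c = d ->
  mdiff f x (velocity c) = velocity d.
Proof. by move=> fs cs <- <-; rewrite velocity_comp. Qed.

End pullbacks.

Section anafunctor.
Variables (R : realType) (X Y : lie_groupoid R) (F : anafunctor X Y).
Let L := ana_lprod F.
Let Q := ana_rprod F.
Let al_s : smooth (anal F). Proof. by case: (anal_submersion F). Qed.
Let src_s (P : lie_groupoid R) : smooth (@src R P).
Proof. by case: (src_submersion P). Qed.
Let tgt_s (P : lie_groupoid R) : smooth (@tgt R P).
Proof. by case: (tgt_submersion P). Qed.
Let L1s : smooth (fp1 L). Proof. exact: fp1_smooth. Qed.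
Let L2s : smooth (fp2 L). Proof. exact: fp2_smooth. Qed.
Let Q1s : smooth (fp1 Q). Proof. exact: fp1_smooth. Qed.
Let Q2s : smooth (fp2 Q). Proof. exact: fp2_smooth. Qed.
Let ls : smooth (lact F). Proof. exact: lact_smooth. Qed.
Let rs : smooth (ract F). Proof. exact: ract_smooth. Qed.

(** Points are described by their components instead of by [fpair] and its proof argument, so that
    the commutation law applies at each time of curves obtained from the universal property.
    [lact_mcomp] does the same for composition. *)
Lemma lact_ract (z z' : L) (q r : Q) : fp1 L z' = fp1 L z -> fp1 Q q = fp2 L z ->
  fp2 L z' = ract F q -> fp1 Q r = lact F z -> fp2 Q r = fp2 Q q ->
  lact F z' = ract F r.
Proof.
move=> z1 qz z2 r1 r2.
have e1 := fp_comm z; have e2 := fp_comm q; rewrite qz in e2.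
have E1 : fpair L e1 = z by apply: (@fp_inj _ _ _ _ _ _ L); rewrite ?fpair1 ?fpair2.
have E2 : fpair Q e2 = q by apply: (@fp_inj _ _ _ _ _ _ Q); rewrite ?fpair1 ?fpair2.
have e3 : src (fp1 L z) = anal F (ract F (fpair Q e2)).
  by rewrite E2 -z2 -z1; exact: fp_comm.
have e4 : anar F (lact F (fpair L e1)) = tgt (fp2 Q q).
  by rewrite E1 -r1 -r2; exact: fp_comm.
have := act_commute e3 e4.
have -> : fpair L e3 = z'.
  by apply: (@fp_inj _ _ _ _ _ _ L); rewrite ?fpair1 ?fpair2 ?E2.
have -> // : fpair Q e4 = r.
by apply: (@fp_inj _ _ _ _ _ _ Q); rewrite ?fpair1 ?fpair2 ?E1.
Qed.

Lemma lact_mcomp (c : comp2 X) (z1 z2 z3 : L) : fp1 L z1 = fp2 (comp2 X) c ->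
  fp1 L z2 = fp1 (comp2 X) c -> fp2 L z2 = lact F z1 ->
  fp1 L z3 = mcomp X c -> fp2 L z3 = fp2 L z1 ->
  lact F z3 = lact F z2.
Proof.
move=> h1 h2 h3 h4 h5.
have e1 := fp_comm c; have e2 := fp_comm z1; rewrite h1 in e2.
have E1 : fpair (comp2 X) e1 = c.
  by apply: (@fp_inj _ _ _ _ _ _ (comp2 X)); rewrite ?fpair1 ?fpair2.
have E2 : fpair L e2 = z1.
  by apply: (@fp_inj _ _ _ _ _ _ L); rewrite ?fpair1 ?fpair2.
have e3 : src (mcomp X (fpair (comp2 X) e1)) = anal F (fp2 L z1).
  by rewrite E1 -h4 -h5; exact: fp_comm.
have e4 : src (fp1 (comp2 X) c) = anal F (lact F (fpair L e2)).
  by rewrite E2 -h3 -h2; exact: fp_comm.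
have := lact_comp e3 e4.
have -> : fpair L e3 = z3.
  by apply: (@fp_inj _ _ _ _ _ _ L); rewrite ?fpair1 ?fpair2 ?E1.
have -> // : fpair L e4 = z2.
by apply: (@fp_inj _ _ _ _ _ _ L); rewrite ?fpair1 ?fpair2 ?E2.
Qed.

(** [K] is the division map of the principal action: it sends [(f, f')] to the pair [(f, eta)] with
    [f'] equal to [f.eta]. *)
Lemma ract_inverse : exists K : ana_sq F -> Q,
  [/\ smooth K, fp1 Q \o K = fp1 (ana_sq F), ract F \o K = fp2 (ana_sq F) &
      forall q q' : Q, fp1 Q q = fp1 Q q' -> ract F q = ract F q' -> q = q'].
Proof.
have [_ [K [Ks PK KP]]] := ana_principal F.
exists K; split => //.
- by apply/funext => s /=; rewrite -[in RHS](KP s) fpair1.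
- by apply/funext => s /=; rewrite -[in RHS](KP s) fpair2.
move=> q q' q1 qr; apply: (can_inj PK).
by apply: (@fp_inj _ _ _ _ _ _ (ana_sq F)); rewrite ?fpair1 ?fpair2.
Qed.

Lemma ract_pair (f f' : F) : anal F f = anal F f' -> exists q : Q,
  [/\ fp1 Q q = f, ract F q = f' & forall v v',
    mdiff (anal F) f v = mdiff (anal F) f' v' ->
    exists w, mdiff (fp1 Q) q w = v /\ mdiff (ract F) q w = v'].
Proof.
move=> ff'; have [K [Ks K1 K2 _]] := ract_inverse.
pose z0 := fpair (ana_sq F) ff'; exists (K z0).
have s1 := @fp1_smooth _ _ _ _ _ _ (ana_sq F).
split.
- by rewrite -[LHS]/((fp1 Q \o K) z0) K1 fpair1.
- by rewrite -[LHS]/((ract F \o K) z0) K2 fpair2.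
move=> v v' vv'.
have [||u [u1 u2]] := @fp_tangent_surj _ _ _ _ _ _ (ana_sq F) z0 v v' al_s al_s.
- by case: (anal_submersion F).
- by rewrite fpair1 fpair2.
have E1 := @mdiff_comp _ _ _ _ K (fp1 Q) z0 u Ks Q1s; rewrite K1 u1 in E1.
have E2 := @mdiff_comp _ _ _ _ K (ract F) z0 u Ks rs; rewrite K2 u2 in E2.
by exists (mdiff K z0 u); split; [exact: esym E1|exact: esym E2].
Qed.

(** Base change of the surjective submersion [anal F] along [src]. *)
Lemma fp1_lprod_submersion : surjective_submersion (fp1 L).
Proof.
have [_ alS alD] := anal_submersion F.
split => // [x|z w].
  have [f e] := alS (src x); exists (fpair L (esym e)); exact: fpair1.
have [v hv] := alD (fp2 L z) (mdiff src (fp1 L z) w).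
have [||u [u1 _]] := @fp_tangent_surj _ _ _ _ _ _ L z w v (src_s X) al_s.
- exact: alD.
- exact: esym.
by exists u.
Qed.

(** The anchor takes [f] to [tgt eta] and [f.eta] to [src eta], so the change of
    [pullback (anar F) b] under the action is minus the [DeltaObj b] term in the change of [a], and
    their sum is invariant. *)
Lemma ana_descent p (V : vectType R) (a : Defs.form p F V)
    (b : Defs.form p (Obj Y) V) :
  pullback (ract F) a =
    form_add (pullback (fp1 Q) a) (pullback (fp2 Q) (DeltaObj b)) ->
  exists psi : Defs.form p (Obj X) V,
    pullback (anal F) psi = form_add a (pullback (anar F) b).
Proof.
move=> aP; have ars := anar_smooth F.
pose w := Form (form_add_is_form a (Form (pullback_is_form b ars))).
have rw : pullback (ract F) w = pullback (fp1 Q) w.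
  have E1 : pullback (ract F) (pullback (anar F) b) = pullback (fp2 Q) (pullback src b).
    exact: pullback_square rs ars Q2s (src_s Y) _ (funext (@anar_ract _ _ _ F)).
  have E2 : pullback (fp1 Q) (pullback (anar F) b) = pullback (fp2 Q) (pullback tgt b).
    exact: pullback_square Q1s ars Q2s (tgt_s Y) _ (funext (@fp_comm _ _ _ _ _ _ Q)).
  rewrite -[LHS]/(form_add (pullback (ract F) a) (pullback (ract F) (pullback (anar F) b))).
  rewrite -[RHS]/(form_add (pullback (fp1 Q) a) (pullback (fp1 Q) (pullback (anar F) b))).
  rewrite aP E1 E2; apply/funext => q; apply/funext => v.
  rewrite /form_add /DeltaObj /form_sub [pullback (fp2 Q) _ _ _]/pullback.
  by rewrite -addrA subrK.
apply: (form_descent (w := w) (anal_submersion F)) => f f' v v' ff' vv'.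
have [q [q1 q2 qD]] := ract_pair ff'.
have [u hu] := choice (fun i => qD _ _ (vv' i)).
have E : pullback (ract F) w q u = pullback (fp1 Q) w q u by rewrite rw.
have E1 := pullback_eq w q1 (fun i => (hu i).1).
have E2 := pullback_eq w q2 (fun i => (hu i).2).
exact: etrans (esym E1) (etrans (esym E) E2).
Qed.

Lemma lift_along_anal (b : line R -> Obj X) (f : F) v : smooth b ->
  b origin = anal F f -> velocity b = mdiff (anal F) f v ->
  exists (phi : line R -> line R) (g : line R -> F), [/\ is_reparam phi, smooth g,
    g origin = f, velocity g = v & anal F \o g = b \o phi].
Proof. by apply: curve_lift => //; case: (anal_submersion F). Qed.

Lemma lprod_tangent_inj (z : L) u u' :
  mdiff (fp1 L) z u = mdiff (fp1 L) z u' -> mdiff (fp2 L) z u = mdiff (fp2 L) z u' ->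
  u = u'.
Proof.
move=> E1 E2; apply/subr0_eq/(@fp_tangent_inj _ _ _ _ _ _ L z) => //.
- by case: (anal_submersion F).
- by rewrite linearB; apply/eqP; rewrite subr_eq0; apply/eqP.
- by rewrite linearB; apply/eqP; rewrite subr_eq0; apply/eqP.
Qed.

(** Here [z = (chi, f)], [z' = (chi, f.eta)], [q = (f, eta)] and [r = (chi.f, eta)]. The vectors
    [ws] are tangent at [q] and [r] and share their [eta] component, which makes the two changes of
    a pullback form equal. *)
Lemma lact_pair (z z' : L) : fp1 L z = fp1 L z' -> exists q r : Q,
  [/\ fp1 Q q = fp2 L z, ract F q = fp2 L z', fp1 Q r = lact F z,
     ract F r = lact F z' & fp2 Q r = fp2 Q q] /\
  forall v v', mdiff (fp1 L) z v = mdiff (fp1 L) z' v' -> exists ws,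
  [/\ mdiff (fp1 Q) q ws.1 = mdiff (fp2 L) z v,
      mdiff (ract F) q ws.1 = mdiff (fp2 L) z' v',
      mdiff (fp1 Q) r ws.2 = mdiff (lact F) z v,
      mdiff (ract F) r ws.2 = mdiff (lact F) z' v' &
      mdiff (fp2 Q) r ws.2 = mdiff (fp2 Q) q ws.1].
Proof.
move=> zz'; have [K [Ks K1 K2 Qinj]] := ract_inverse.
have ff' : anal F (fp2 L z) = anal F (fp2 L z').
  by have := fp_comm z'; rewrite -zz' => <-; exact: esym (fp_comm z).
pose q := K (fpair (ana_sq F) ff').
have q1 : fp1 Q q = fp2 L z by rewrite -[LHS]/((fp1 Q \o K) _) K1 fpair1.
have q2 : ract F q = fp2 L z' by rewrite -[LHS]/((ract F \o K) _) K2 fpair2.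
have er : anar F (lact F z) = tgt (fp2 Q q).
  by rewrite anar_lact -(fp_comm q) q1.
pose r := fpair Q er.
have r1 : fp1 Q r = lact F z by exact: fpair1.
have r2 : fp2 Q r = fp2 Q q by exact: fpair2.
exists q, r; split.
  split => //; exact/esym/(@lact_ract z z' q r).
move=> v v' vv'.
have [c [cs c0 cv]] := @curve_through _ _ z v.
have L2c : smooth (fp2 L \o c) by exact: smooth_comp.
have bs : smooth (anal F \o (fp2 L \o c)) by exact: smooth_comp.
have sal : src \o fp1 L = anal F \o fp2 L by apply/funext; exact: fp_comm.
have b0 : (anal F \o (fp2 L \o c)) origin = anal F (fp2 L z') by rewrite /= c0.
have bv : velocity (anal F \o (fp2 L \o c)) = mdiff (anal F) (fp2 L z') (mdiff (fp2 L) z' v').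
  have E1 := mdiff_comp z v L1s (src_s X).
  have E2 := mdiff_comp z v L2s al_s.
  have E1' := mdiff_comp z' v' L1s (src_s X).
  have E2' := mdiff_comp z' v' L2s al_s.
  rewrite sal in E1 E1'.
  have E3 : mdiff (anal F \o fp2 L) z v = mdiff (anal F \o fp2 L) z' v'.
    by rewrite E1 E1' zz' vv'.
  have s3 : smooth (anal F \o fp2 L) by exact: smooth_comp.
  have E4 := mdiff_velocity s3 cs c0 erefl; rewrite cv in E4.
  exact: etrans (esym E4) (etrans E3 E2').
(* [g] is a curve of second points [f.eta], over the same objects as the curve of points [f], with
   the velocity prescribed by [v']. *)
have [phi [g [ph gs g0 gv gE]]] := lift_along_anal bs b0 bv.
have [ps p0 _] := ph.
pose d := c \o phi; have ds : smooth d by exact: smooth_comp.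
have d0 : d origin = z by rewrite /d /= p0.
have dv : velocity d = v by rewrite velocity_reparam.
have L1d : smooth (fp1 L \o d) by exact: smooth_comp.
have L2d : smooth (fp2 L \o d) by exact: smooth_comp.
have ld : smooth (lact F \o d) by exact: smooth_comp.
have gt t : anal F (fp2 L (d t)) = anal F (g t) by exact: esym (comp_eqE gE t).
have [sg [sgs sg1 sg2]] := @fp_lift _ _ _ _ _ _ (ana_sq F) _ _ _ L2d gs gt.
pose qt := K \o sg; have qs : smooth qt by exact: smooth_comp.
have qt1 : fp1 Q \o qt = fp2 L \o d by rewrite -sg1 -K1.
have qt2 : ract F \o qt = g by rewrite -sg2 -K2.
have qt0 : qt origin = q.
  apply: Qinj.
    by rewrite -[LHS]/((fp1 Q \o qt) origin) qt1 /= d0.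
  by rewrite -[LHS]/((ract F \o qt) origin) qt2 g0.
have st t : src (fp1 L (d t)) = anal F (g t) by rewrite -gt; exact: fp_comm.
have [z't [zs zt1 zt2]] := @fp_lift _ _ _ _ _ _ L _ _ _ L1d gs st.
have zt0 : z't origin = z'.
  apply: (@fp_inj _ _ _ _ _ _ L).
    by rewrite -[LHS]/((fp1 L \o z't) origin) zt1 /= d0.
  by rewrite -[LHS]/((fp2 L \o z't) origin) zt2 g0.
(* The vector [v'] is given, whereas [z't] was built from its components; injectivity on tangent
   vectors of the fibre product identifies the two. *)
have ztv : velocity z't = v'.
  apply: (@lprod_tangent_inj z').
    rewrite (mdiff_velocity L1s zs zt0 zt1) -vv' -dv.
    exact: esym (mdiff_velocity L1s ds d0 erefl).
  by rewrite (mdiff_velocity L2s zs zt0 zt2).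
have Q2q : smooth (fp2 Q \o qt) by exact: smooth_comp.
have rt t : anar F (lact F (d t)) = tgt (fp2 Q (qt t)).
  rewrite anar_lact -(fp_comm (qt t)); congr (anar F _).
  exact: esym (comp_eqE qt1 t).
have [R' [R's R1 R2]] := @fp_lift _ _ _ _ _ _ Q _ _ _ ld Q2q rt.
have R0 : R' origin = r.
  apply: (@fp_inj _ _ _ _ _ _ Q).
    by rewrite -[LHS]/((fp1 Q \o R') origin) R1 /= d0.
  by rewrite -[LHS]/((fp2 Q \o R') origin) R2 /= qt0.
have RE : ract F \o R' = lact F \o z't.
  apply/funext => t; apply/esym/(@lact_ract (d t) (z't t) (qt t) (R' t)).
  - exact: comp_eqE zt1 t.
  - exact: comp_eqE qt1 t.
  - exact: etrans (comp_eqE zt2 t) (esym (comp_eqE qt2 t)).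
  - exact: comp_eqE R1 t.
  - exact: comp_eqE R2 t.
exists (velocity qt, velocity R'); split => /=.
- rewrite (mdiff_velocity Q1s qs qt0 qt1) -dv.
  exact: esym (mdiff_velocity L2s ds d0 erefl).
- by rewrite (mdiff_velocity rs qs qt0 qt2).
- rewrite (mdiff_velocity Q1s R's R0 R1) -dv.
  exact: esym (mdiff_velocity ls ds d0 erefl).
- rewrite (mdiff_velocity rs R's R0 RE) -ztv.
  exact: esym (mdiff_velocity ls zs zt0 erefl).
- rewrite (mdiff_velocity Q2s R's R0 R2).
  exact: esym (mdiff_velocity Q2s qs qt0 erefl).
Qed.

End anafunctor.

Lemma subr_eq_shift (V : zmodType) (a b a' b' c : V) :
  a' = a + c -> b' = b + c -> a - b = a' - b'.
Proof. by move=> -> ->; rewrite opprD addrACA subrr addr0. Qed.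

(** * The descended form on morphisms and its cocycle identity *)

Section morphism_form.
Variables (R : realType) (X Y : lie_groupoid R) (F : anafunctor X Y).
Let L := ana_lprod F.
Let Q := ana_rprod F.
Let C := comp2 X.
Let al_s : smooth (anal F). Proof. by case: (anal_submersion F). Qed.
Let src_s : smooth (@src R X). Proof. by case: (src_submersion X). Qed.
Let tgt_s : smooth (@tgt R X). Proof. by case: (tgt_submersion X). Qed.
Let L1s : smooth (fp1 L). Proof. exact: fp1_smooth. Qed.
Let L2s : smooth (fp2 L). Proof. exact: fp2_smooth. Qed.
Let C1s : smooth (fp1 C). Proof. exact: fp1_smooth. Qed.
Let C2s : smooth (fp2 C). Proof. exact: fp2_smooth. Qed.
Let Cs : smooth (mcomp X). Proof. exact: comp_smooth. Qed.
Let ls : smooth (lact F). Proof. exact: lact_smooth. Qed.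

(** For [c = (chi1, chi2)] and an [f] over the source of [chi2], the points are [z1 = (chi2, f)],
    [z2 = (chi1, chi2.f)] and [z3 = (chi1 chi2, f)]; a lifted curve of points [f] supplies matching
    tangent vectors. *)
Lemma lact_mcomp_tangents (c : C) : exists z1 z2 z3 : L,
  [/\ [/\ fp1 L z1 = fp2 C c, fp1 L z2 = fp1 C c & fp1 L z3 = mcomp X c],
      [/\ fp2 L z2 = lact F z1, fp2 L z3 = fp2 L z1 & lact F z3 = lact F z2] &
  forall u, exists us : 'rV[R]_(mdim L) * 'rV[R]_(mdim L) * 'rV[R]_(mdim L),
  [/\ mdiff (fp1 L) z1 us.1.1 = mdiff (fp2 C) c u,
      mdiff (fp1 L) z2 us.1.2 = mdiff (fp1 C) c u &
      mdiff (fp1 L) z3 us.2 = mdiff (mcomp X) c u] /\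
  [/\ mdiff (fp2 L) z2 us.1.2 = mdiff (lact F) z1 us.1.1,
      mdiff (fp2 L) z3 us.2 = mdiff (fp2 L) z1 us.1.1 &
      mdiff (lact F) z3 us.2 = mdiff (lact F) z2 us.1.2]].
Proof.
have [_ alS alD] := anal_submersion F.
have [f0 hf0] := alS (src (fp2 C c)).
pose z1 := fpair L (esym hf0).
have z11 : fp1 L z1 = fp2 C c by exact: fpair1.
have z12 : fp2 L z1 = f0 by exact: fpair2.
have e2 : src (fp1 C c) = anal F (lact F z1).
  by rewrite anal_lact z11; exact: fp_comm.
pose z2 := fpair L e2.
have z21 : fp1 L z2 = fp1 C c by exact: fpair1.
have z22 : fp2 L z2 = lact F z1 by exact: fpair2.
have e3 : src (mcomp X c) = anal F f0 by rewrite src_comp.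
pose z3 := fpair L e3.
have z31 : fp1 L z3 = mcomp X c by exact: fpair1.
have z32 : fp2 L z3 = f0 by exact: fpair2.
exists z1, z2, z3; split => [//||u].
  by split; [exact: z22|rewrite z32 z12|apply: (lact_mcomp z11 z21 z22 z31); rewrite z32].
have [k [ks k0 kv]] := @curve_through _ _ c u.
have C2k : smooth (fp2 C \o k) by exact: smooth_comp.
have bs : smooth (src \o (fp2 C \o k)) by exact: smooth_comp.
have b0 : (src \o (fp2 C \o k)) origin = anal F f0 by rewrite /= k0.
have [v hv] := alD f0 (velocity (src \o (fp2 C \o k))).
have [phi [g [ph gs g0 gv gE]]] := lift_along_anal bs b0 (esym hv).
have [ps p0 _] := ph.
pose d := k \o phi; have ds : smooth d by exact: smooth_comp.
have d0 : d origin = c by rewrite /d /= p0.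
have dv : velocity d = u by rewrite velocity_reparam.
have C1d : smooth (fp1 C \o d) by exact: smooth_comp.
have C2d : smooth (fp2 C \o d) by exact: smooth_comp.
have Cd : smooth (mcomp X \o d) by exact: smooth_comp.
have gt t : src (fp2 C (d t)) = anal F (g t) by exact: esym (comp_eqE gE t).
have [z1t [s1 t11 t12]] := @fp_lift _ _ _ _ _ _ L _ _ _ C2d gs gt.
have l1 : smooth (lact F \o z1t) by exact: smooth_comp.
have e2t t : src (fp1 C (d t)) = anal F (lact F (z1t t)).
  by rewrite anal_lact (comp_eqE t11 t); exact: fp_comm.
have [z2t [s2 t21 t22]] := @fp_lift _ _ _ _ _ _ L _ _ _ C1d l1 e2t.
have e3t t : src (mcomp X (d t)) = anal F (g t) by rewrite src_comp.
have [z3t [s3 t31 t32]] := @fp_lift _ _ _ _ _ _ L _ _ _ Cd gs e3t.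
have o1 : z1t origin = z1.
  apply: (@fp_inj _ _ _ _ _ _ L).
    by rewrite (comp_eqE t11) z11 /= d0.
  by rewrite (comp_eqE t12) z12 g0.
have o2 : z2t origin = z2.
  apply: (@fp_inj _ _ _ _ _ _ L).
    by rewrite (comp_eqE t21) z21 /= d0.
  by rewrite (comp_eqE t22) z22 /= o1.
have o3 : z3t origin = z3.
  apply: (@fp_inj _ _ _ _ _ _ L).
    by rewrite (comp_eqE t31) z31 /= d0.
  by rewrite (comp_eqE t32) z32 g0.
have lE : lact F \o z3t = lact F \o z2t.
  apply/funext => t; apply: (@lact_mcomp _ _ _ F (d t) (z1t t) (z2t t) (z3t t)).
  - exact: comp_eqE t11 t.
  - exact: comp_eqE t21 t.
  - exact: comp_eqE t22 t.
  - exact: comp_eqE t31 t.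
  - exact: etrans (comp_eqE t32 t) (esym (comp_eqE t12 t)).
exists (velocity z1t, velocity z2t, velocity z3t); split; split => /=.
- rewrite (mdiff_velocity L1s s1 o1 t11) -dv.
  exact: esym (mdiff_velocity C2s ds d0 erefl).
- rewrite (mdiff_velocity L1s s2 o2 t21) -dv.
  exact: esym (mdiff_velocity C1s ds d0 erefl).
- rewrite (mdiff_velocity L1s s3 o3 t31) -dv.
  exact: esym (mdiff_velocity Cs ds d0 erefl).
- rewrite (mdiff_velocity L2s s2 o2 t22).
  exact: esym (mdiff_velocity ls s1 o1 erefl).
- rewrite (mdiff_velocity L2s s3 o3 t32).
  exact: esym (mdiff_velocity L2s s1 o1 t12).
- rewrite (mdiff_velocity ls s3 o3 lE).
  exact: esym (mdiff_velocity ls s2 o2 erefl).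
Qed.

Variables (p : nat) (V : vectType R) (nu : Defs.form p F V).

(** Passing from [(chi, f)] to [(chi, f.eta)] adds the same value of [b] to [nu] at [chi.f] and to
    [nu] at [f], so their difference depends on [chi] alone. *)
Lemma lact_descent (b : Defs.form p (Mor Y) V) :
  pullback (ract F) nu = form_add (pullback (fp1 Q) nu) (pullback (fp2 Q) b) ->
  exists psi : Defs.form p (Mor X) V,
    pullback (lact F) nu = form_add (pullback (fp1 L) psi) (pullback (fp2 L) nu).
Proof.
move=> nuP.
pose B := Form (form_sub_is_form (Form (pullback_is_form nu ls))
                                 (Form (pullback_is_form nu L2s))).
have nuE q w : pullback (ract F) nu q w =
    pullback (fp1 Q) nu q w + pullback (fp2 Q) b q w by rewrite nuP.
have [z z' v v' zz' vv'|psi psiB] := form_descent (w := B) (fp1_lprod_submersion F).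
  have [q [r [[q1 q2 r1 r2 r3] H]]] := lact_pair zz'.
  have [ws hws] := choice (fun i => H _ _ (vv' i)).
  pose w i := (ws i).1; pose s i := (ws i).2.
  have Eq := nuE q w; have Er := nuE r s.
  have w1 i : mdiff (fp1 Q) q (w i) = mdiff (fp2 L) z (v i) :=
    let: And5 h _ _ _ _ := hws i in h.
  have w2 i : mdiff (ract F) q (w i) = mdiff (fp2 L) z' (v' i) :=
    let: And5 _ h _ _ _ := hws i in h.
  have w3 i : mdiff (fp1 Q) r (s i) = mdiff (lact F) z (v i) :=
    let: And5 _ _ h _ _ := hws i in h.
  have w4 i : mdiff (ract F) r (s i) = mdiff (lact F) z' (v' i) :=
    let: And5 _ _ _ h _ := hws i in h.
  have w5 i : mdiff (fp2 Q) r (s i) = mdiff (fp2 Q) q (w i) :=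
    let: And5 _ _ _ _ h := hws i in h.
  have e1 : pullback (fp1 Q) nu q w = pullback (fp2 L) nu z v :=
    pullback_eq nu q1 w1.
  have e2 : pullback (ract F) nu q w = pullback (fp2 L) nu z' v' :=
    pullback_eq nu q2 w2.
  have e3 : pullback (fp1 Q) nu r s = pullback (lact F) nu z v :=
    pullback_eq nu r1 w3.
  have e4 : pullback (ract F) nu r s = pullback (lact F) nu z' v' :=
    pullback_eq nu r2 w4.
  have e5 : pullback (fp2 Q) b r s = pullback (fp2 Q) b q w :=
    pullback_eq b r3 w5.
  exact: subr_eq_shift (etrans (esym e4) (etrans Er (congr2 +%R e3 e5)))
    (etrans (esym e2) (etrans Eq (congr1 (+%R^~ _) e1))).
exists psi; rewrite psiB; apply/funext => z; apply/funext => v.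
by rewrite /form_add /= /form_sub subrK.
Qed.

(** [psi] at [chi] is [nu] at [chi.f] minus [nu] at [f], so the alternating sum over [chi1],
    [chi1 chi2], [chi2] telescopes. *)
Lemma DeltaMor_descent (psi : Defs.form p (Mor X) V) :
  pullback (lact F) nu = form_add (pullback (fp1 L) psi) (pullback (fp2 L) nu) ->
  DeltaMor psi = fun _ _ => 0.
Proof.
move=> psiP; apply/funext => c; apply/funext => v.
have psiE z u : pullback (fp1 L) psi z u =
    pullback (lact F) nu z u - pullback (fp2 L) nu z u.
  by rewrite psiP /form_add addrK.
have [z1 [z2 [z3 [[z11 z21 z31] [z22 z32 z3l] H]]]] := lact_mcomp_tangents c.
have [us hus] := choice (fun i => H (v i)).
pose u1 i := (us i).1.1; pose u2 i := (us i).1.2; pose u3 i := (us i).2.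
have a1 i : mdiff (fp1 L) z1 (u1 i) = mdiff (fp2 C) c (v i) :=
  let: conj (And3 h _ _) _ := hus i in h.
have a2 i : mdiff (fp1 L) z2 (u2 i) = mdiff (fp1 C) c (v i) :=
  let: conj (And3 _ h _) _ := hus i in h.
have a3 i : mdiff (fp1 L) z3 (u3 i) = mdiff (mcomp X) c (v i) :=
  let: conj (And3 _ _ h) _ := hus i in h.
have b1 i : mdiff (fp2 L) z2 (u2 i) = mdiff (lact F) z1 (u1 i) :=
  let: conj _ (And3 h _ _) := hus i in h.
have b2 i : mdiff (fp2 L) z3 (u3 i) = mdiff (fp2 L) z1 (u1 i) :=
  let: conj _ (And3 _ h _) := hus i in h.
have b3 i : mdiff (lact F) z3 (u3 i) = mdiff (lact F) z2 (u2 i) :=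
  let: conj _ (And3 _ _ h) := hus i in h.
have E1 := psiE z1 u1; have E2 := psiE z2 u2; have E3 := psiE z3 u3.
have d1 : pullback (fp1 L) psi z1 u1 = pullback (fp2 C) psi c v :=
  pullback_eq psi z11 a1.
have d2 : pullback (fp1 L) psi z2 u2 = pullback (fp1 C) psi c v :=
  pullback_eq psi z21 a2.
have d3 : pullback (fp1 L) psi z3 u3 = pullback (mcomp X) psi c v :=
  pullback_eq psi z31 a3.
have n1 : pullback (fp2 L) nu z2 u2 = pullback (lact F) nu z1 u1 :=
  pullback_eq nu z22 b1.
have n2 : pullback (fp2 L) nu z3 u3 = pullback (fp2 L) nu z1 u1 :=
  pullback_eq nu z32 b2.
have n3 : pullback (lact F) nu z3 u3 = pullback (lact F) nu z2 u2 :=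
  pullback_eq nu z3l b3.
have cocycle (a b c0 : V) : (b - a) - (b - c0) + (a - c0) = 0.
  by rewrite opprB [b - a + _]addrC !subrKA subrr.
set ta := pullback (lact F) nu z1 u1 in E1 n1.
set tb := pullback (lact F) nu z2 u2 in E2 n3.
set tc := pullback (fp2 L) nu z1 u1 in E1 n2.
have D2 : pullback (fp1 C) psi c v = tb - ta.
  exact: etrans (esym d2) (etrans E2 (congr1 (fun t => _ - t) n1)).
have D3 : pullback (mcomp X) psi c v = tb - tc.
  exact: etrans (esym d3) (etrans E3 (congr2 (fun s t => s - t) n3 n2)).
have D1 : pullback (fp2 C) psi c v = ta - tc := etrans (esym d1) E1.
have E : pullback (fp1 C) psi c v - pullback (mcomp X) psi c v +
    pullback (fp2 C) psi c v = 0.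
  by rewrite D2 D3 D1; exact: cocycle.
exact: E.
Qed.

End morphism_form.

(** Over [(chi, f)], the left side compares [psia] at the anchors of [chi.f] and [f]. The right
    anchor is the same at both points, so the [b] terms cancel and [t] of the difference of [nu]
    remains. *)
Lemma DeltaObj_descent (R : realType) (X Y : lie_groupoid R) (F : anafunctor X Y)
    (p : nat) (V W : vectType R) (t : {linear V -> W}) (nu : Defs.form p F V)
    (b : Defs.form p (Obj Y) W) (psia : Defs.form p (Obj X) W)
    (psib : Defs.form p (Mor X) V) :
  pullback (anal F) psia = form_add (form_map t nu) (pullback (anar F) b) ->
  pullback (lact F) nu = form_add (pullback (fp1 (ana_lprod F)) psib)
    (pullback (fp2 (ana_lprod F)) nu) ->
  DeltaObj psia = form_map t psib.
Proof.
move=> hpa hpb; apply: (pullback_inj (fp1_lprod_submersion F)).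
set L := ana_lprod F.
have L1s : smooth (fp1 L) by exact: fp1_smooth.
have L2s : smooth (fp2 L) by exact: fp2_smooth.
have ls : smooth (lact F) by exact: lact_smooth.
have ars : smooth (anar F) by exact: anar_smooth.
have al_s : smooth (anal F) by case: (anal_submersion F).
have src_s : smooth (@src R X) by case: (src_submersion X).
have tgt_s : smooth (@tgt R X) by case: (tgt_submersion X).
have E1 : pullback (fp1 L) (pullback tgt psia) = pullback (lact F) (pullback (anal F) psia).
  exact: pullback_square L1s tgt_s ls al_s _ (esym (funext (@anal_lact _ _ _ F))).
have E2 : pullback (fp1 L) (pullback src psia) = pullback (fp2 L) (pullback (anal F) psia).
  exact: pullback_square L1s src_s L2s al_s _ (funext (@fp_comm _ _ _ _ _ _ L)).
have E3 : pullback (lact F) (pullback (anar F) b) = pullback (fp2 L) (pullback (anar F) b).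
  exact (pullback_square ls ars L2s ars _ (funext (@anar_lact _ _ _ F))).
apply/funext => z; apply/funext => v.
have B : pullback (lact F) nu z v = pullback (fp1 L) psib z v + pullback (fp2 L) nu z v.
  by rewrite hpb.
have e1 : pullback (fp1 L) (pullback tgt psia) z v =
    t (pullback (lact F) nu z v) + pullback (fp2 L) (pullback (anar F) b) z v.
  rewrite E1 hpa.
  exact (congr1 (fun w => t (pullback (lact F) nu z v) + w z v) E3).
have e2 : pullback (fp1 L) (pullback src psia) z v =
    t (pullback (fp2 L) nu z v) + pullback (fp2 L) (pullback (anar F) b) z v.
  rewrite E2 hpa.
  exact (erefl (t (pullback (fp2 L) nu z v) + pullback (fp2 L) (pullback (anar F) b) z v)).
have e : pullback (fp1 L) (pullback tgt psia) z v -
    pullback (fp1 L) (pullback src psia) z v = t (pullback (fp1 L) psib z v).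
  have tsub (x y k : W) (c d c' : V) : x = t c + k -> y = t d + k -> c = c' + d ->
      x - y = t c'.
    by move=> -> -> ->; rewrite linearD opprD addrACA subrr addr0 addrK.
  exact: tsub e1 e2 B.
exact: e.
Qed.

(** * Existence and uniqueness of the form on X *)

Lemma form_subP (R : realType) p (M : manifold R) (V : vectType R)
    (a b c : pre_form p M V) : a = form_sub b c <-> b = form_add a c.
Proof.
by split=> ->; apply/funext => x; apply/funext => v;
  rewrite /form_add /form_sub ?subrK ?addrK.
Qed.

Lemma form_addIr (R : realType) p (M : manifold R) (V : vectType R)
    (c : pre_form p M V) : injective (fun a => form_add a c).
Proof.
move=> a b E; apply/funext => x; apply/funext => v.
have E1 : form_add a c x v = form_add b c x v by move: E => /= ->.
exact: addIr E1.
Qed.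

Lemma gform_inj (R : realType) p (P : lie_groupoid R) (gamma : lie2_algebra R)
    (Psi Psi' : gform p P gamma) : form_val (gfa Psi) = form_val (gfa Psi') ->
  form_val (gfb Psi) = form_val (gfb Psi') ->
  form_val (gfc Psi) = form_val (gfc Psi') -> Psi = Psi'.
Proof.
case: Psi => a b c ab bb; case: Psi' => a' b' c' ab' bb' /=.
move=> /form_val_inj ea /form_val_inj eb /form_val_inj ec; subst a' b' c'.
by congr GForm; exact: Prop_irrelevance.
Qed.

Theorem lemma4p3p3 (R : realType) (Gamma : lie_2group R)
    (gamma : lie2_algebra R) (hgamma : is_lie2_algebra_of Gamma gamma)
    (X Y : lie_groupoid R) (F : anafunctor X Y) (p : nat)
    (Phi : gform p Y gamma) (nu : Phi_pullback F Phi) :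
  exists! Psi : gform p X gamma,
    [/\ form_map (l2t gamma) (nu0 nu) =
          (pullback (anal F) (gfa Psi) - pullback (anar F) (gfa Phi))%form,
        pullback (lact F) (nu0 nu) =
          (pullback (fp1 (ana_lprod F)) (gfb Psi)
           + pullback (fp2 (ana_lprod F)) (nu0 nu))%form &
        form_val (nu1 nu) =
          (pullback (anal F) (gfc Psi) - pullback (anar F) (gfc Phi))%form].
Proof.
pose tnu := Form (form_map_is_form (l2t gamma) (nu0 nu)).
(* Applying [l2t gamma] to the equation for [nu0] turns [gfb Phi] into [DeltaObj (gfa Phi)], the
   shape required for descent to objects. *)
have tnuP : pullback (ract F) tnu = form_add (pullback (fp1 (ana_rprod F)) tnu)
    (pullback (fp2 (ana_rprod F)) (DeltaObj (gfa Phi))).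
  rewrite (gfa_Delta Phi); apply/funext => q; apply/funext => v.
  have E : pullback (ract F) (nu0 nu) q v = pullback (fp1 (ana_rprod F)) (nu0 nu) q v +
      pullback (fp2 (ana_rprod F)) (gfb Phi) q v by rewrite nu0P.
  have E1 := congr1 (l2t gamma) E; rewrite linearD in E1.
  exact: E1.
have [psia ha] := ana_descent tnuP.
have [psib hb] := lact_descent (nu0P nu).
have [psic hc] := ana_descent (nu1P nu).
have D := DeltaMor_descent hb.
have Da := DeltaObj_descent ha hb.
exists (GForm psic Da D); split=> [|Psi' [ha' hb' hc']].
  split; first exact/form_subP.
    exact: hb.
  exact/form_subP.
have sub := anal_submersion F.
apply: gform_inj => /=.
- apply: (pullback_inj sub); apply: etrans ha _.
  by apply/esym/form_subP.
- apply: (pullback_inj (fp1_lprod_submersion F)).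
  by apply: (@form_addIr _ _ _ _ (pullback (fp2 (ana_lprod F)) (nu0 nu))); rewrite -hb -hb'.
- apply: (pullback_inj sub); apply: etrans hc _.
  by apply/esym/form_subP.
Qed.
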